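(* Let $\{X_j\}$ be a (strictly) stationary sequence of real random variables with continuous marginal distribution function $F(x)=\mathbb{P}(X_1\le x)$ such that for some constants $b>0$ and $B>0$ $$F(x+u)-F(x)\le B u^b,\qquad x\in\mathbb{R},\ u>0.$$ If $\{X_j\}$ is $\kappa$-weakly dependent and $$\kappa(r)=\mathcal{O}(r^{-\beta})\quad\text{for some }\beta>\big(1+\sqrt5\big)\Big(1+\frac2b\Big),$$ then $\{X_j\}$ admits a continuous phantom distribution function.
   Context: $M_n=\max_{1\le j\le n}X_j$. A distribution function $G$ is a phantom distribution function for the stationary sequence $\{X_j\}$ if $\sup_{u\in\mathbb{R}}|\mathbb{P}(M_n\le u)-G^n(u)|\to 0$ as $n\to\infty$, where $G^n(u)=(G(u))^n$. For $s\in\mathbb{N}$ let $\mathcal{M}^s$ be the family of all measurable non-constant functions $f:\mathbb{R}^s\to\mathbb{R}$ with $\sup|f|\le 1$. For $f\in\mathcal{M}^s$ put $$\mathrm{Lip}\, f=\sup_{(y_1,\dots,y_s)\ne(x_1,\dots,x_s)}\frac{|f(y_1,\dots,y_s)-f(x_1,\dots,x_s)|}{|y_1-x_1|+\cdots+|y_s-x_s|}\in(0,+\infty].$$ The $\kappa$-weak dependence coefficient is $$\kappa(r)=\sup\frac{\left|\mathrm{Cov}\left(f(X_{i_1},\dots,X_{i_s}),g(X_{j_1},\dots,X_{j_t})\right)\right|}{s\,t\,\mathrm{Lip}\, f\cdot\mathrm{Lip}\, g},$$ the supremum being over all $s,t\in\mathbb{N}$, $f\in\mathcal{M}^s$, $g\in\mathcal{M}^t$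 and all indices $i_1\le\cdots\le i_s\le j_1\le\cdots\le j_t$ with $j_1-i_s\ge r$ (the ratio is $0$ when the denominator is $+\infty$). The sequence is $\kappa$-weakly dependent if $\kappa(r)\to 0$ as $r\to\infty$. *)

(* Defs.v *)
From HB Require Import structures.
From mathcomp Require Import all_boot all_order all_algebra.
From mathcomp Require Import all_classical all_reals all_analysis.

Set Implicit Arguments.
Unset Strict Implicit.
Unset Printing Implicit Defensive.

Import Order.TTheory GRing.Theory Num.Theory.
Import numFieldNormedType.Exports.

Local Open Scope classical_set_scope.
Local Open Scope ring_scope.

(* Sequences are indexed from 0: the function [X : nat -> {RV P >-> R}] stands
   for the sequence X_1, X_2, ..., with [X j] in the role of X_{j+1}. *)

Definition sample d (T : measurableType d) (R : realType) (P : probability T R)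
    (X : nat -> {RV P >-> R}) (s : nat) (i : s.-tuple nat) (w : T) :
    s.-tuple R :=
  [tuple X (tnth i k) w | k < s].

Definition strictly_stationary d (T : measurableType d) (R : realType)
    (P : probability T R) (X : nat -> {RV P >-> R}) : Prop :=
  forall (n k : nat) (A : set (n.-tuple R)), measurable A ->
    P [set w | A [tuple X (j + k)%N w | j < n]] =
    P [set w | A [tuple X j w | j < n]].

Definition marginal_df d (T : measurableType d) (R : realType)
    (P : probability T R) (X : nat -> {RV P >-> R}) (x : R) : R :=
  fine (cdf (X 0%N) x).

(* M_n, the maximum of the first n variables; the value at n = 0 is a dummy *)
Definition partial_max d (T : measurableType d) (R : realType)
    (P : probability T R) (X : nat -> {RV P >-> R}) (n : nat) (w : T) : R :=
  \big[Num.max/X 0%N w]_(j < n) X j w.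

(* Distribution functions on R are the elements of [cumulativeBounded 0 1]:
   nondecreasing, right-continuous, with limits 0 at -oo and 1 at +oo. *)
Definition phantom_df d (T : measurableType d) (R : realType)
    (P : probability T R) (X : nat -> {RV P >-> R})
    (G : cumulativeBounded (0 : R) (1 : R)) : Prop :=
  (fun n : nat => ereal_sup (range (fun u : R =>
     `| P [set w | (partial_max X n w <= u)%R] - (G u ^+ n)%:E |%E)))
  @ \oo --> 0%E.

(* the family M^s; [s.-tuple R] carries the product Borel sigma-algebra *)
Definition test_function (R : realType) (s : nat) (f : s.-tuple R -> R) : Prop :=
  [/\ measurable_fun [set: s.-tuple R] f,
      exists x y, f x <> f y
    & forall x, `|f x| <= 1].

Definition Lip (R : realType) (s : nat) (f : s.-tuple R -> R) : \bar R :=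
  ereal_sup [set z : \bar R | exists x y : s.-tuple R, y <> x /\
    z = (`|f y - f x| / \sum_(k < s) `|tnth y k - tnth x k|)%:E].

(* In the extended reals inverting +oo gives 0, so the ratio vanishes as soon
   as [Lip f] or [Lip g] is +oo; both are > 0 because f and g are not constant.
   The supremum may be +oo for small r. *)
Definition kappa d (T : measurableType d) (R : realType) (P : probability T R)
    (X : nat -> {RV P >-> R}) (r : nat) : \bar R :=
  ereal_sup [set z : \bar R | exists (s t : nat)
      (f : s.-tuple R -> R) (g : t.-tuple R -> R)
      (i : s.-tuple nat) (j : t.-tuple nat),
    [/\ (0 < s)%N /\ (0 < t)%N,
        test_function f /\ test_function g,
        sorted leq (i ++ j),
        (last 0 i + r <= head 0 j)%N
      & z = (`| covariance P (f \o sample X i) (g \o sample X j) | /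
             (s%:R%:E * t%:R%:E * (Lip f * Lip g)))%E]].

Definition kappa_weakly_dependent d (T : measurableType d) (R : realType)
    (P : probability T R) (X : nat -> {RV P >-> R}) : Prop :=
  kappa X @ \oo --> 0%E.

Definition kappa_rate d (T : measurableType d) (R : realType)
    (P : probability T R) (X : nat -> {RV P >-> R}) (beta : R) : Prop :=
  exists C : R, \forall r \near \oo,
    (kappa X r <= (C * r%:R `^ (- beta))%:E)%E.

(* Main.v *)
(* Write H_n(u) = P(M_n <= u). Replacing indicators by ramps of width
   r^(-1/b - 1/2) and using kappa and the Hoelder bound on F shows that two blocks
   separated by a gap r, of lengths at most a fixed multiple of r, are
   asymptotically independent, uniformly in the level u. Iterating this along
   consecutive blocks, H_m(u) >= 1/e with m large forces H_(m/L)(u) ~ 1 for some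
   fixed L, so that a gap of length m/L can be filled in and
   H_(p+q)(u) ~ H_p(u) H_q(u) for p + q = O(m). A nonincreasing almost
   multiplicative sequence with H_m(u) > 1/e >= H_(m+1)(u) satisfies
   H_n(u) ~ e^(-n/m) uniformly in n, so any G with G(u) ~ e^(-1/m) is a phantom
   distribution function; such a G that is continuous is written down explicitly. *)

Require Import Defs.
From HB Require Import structures.
From mathcomp Require Import all_boot all_order all_algebra.
From mathcomp Require Import all_classical all_reals all_analysis.
From mathcomp Require Import measurable_realfun.
From mathcomp Require Import zify ring lra.
Set Implicit Arguments.
Unset Strict Implicit.
Unset Printing Implicit Defensive.
Import Order.TTheory GRing.Theory Num.Theory.
Import numFieldNormedType.Exports.
Local Open Scope classical_set_scope.
Local Open Scope ring_scope.

(** * Almost multiplicative sequences *)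

(** The difficulty is uniformity in the level [u]. The lower half of block mixing loses [1 - h u r],
    which is not small at low levels, whereas the upper half is valid at every level. So the upper
    half is used alone first: if a short block failed to be almost sure, many separated copies of it
    would push [h u m] below 1/e. Only then can gaps be filled, and only along lengths comparable to
    the [m] at which [h u] crosses 1/e. This [m] depends on [u], and the approximation by e^(-n/m)
    is good only for large [m]. Hence three regimes: [m] large, where the approximation applies; [m]
    bounded, where both H_n(u) and G(u)^n tend to 0 uniformly in [u]; and no crossing at all, where
    H_n(u) = 1 for all n and G(u) = 1. For G itself the delicate point is continuity: a supremum of
    infinitely many continuous functions need not be continuous, so finitely many terms must
    determine it up to a small error, with their number independent of [u]. *)

Lemma expR_lipschitz (R : realType) (x y : R) : 0 <= x -> 0 <= y ->
  `|expR (- x) - expR (- y)| <= `|x - y|.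
Proof.
wlog le_xy : x y / x <= y => [hw x0 y0|x0 _].
  by case: (leP x y) => [/hw|/ltW /hw]; [exact|rewrite distrC (distrC x); exact].
rewrite [leLHS]ger0_norm ?subr_ge0 ?ler_expR ?lerN2//.
rewrite [leRHS]ler0_norm ?subr_le0// opprB.
have -> : expR (- y) = expR (- x) * expR (x - y).
  by rewrite -expRD; congr expR; lra.
have := expR_ge1Dx (x - y); have := expR_gt0 (x - y).
have : expR (- x) <= 1 by rewrite -expR0 ler_expR; lra.
have := expR_gt0 (- x); nra.
Qed.

Lemma nonincreasing_sandwich (R : realType) (h : nat -> R) (l n : nat) :
  {homo h : i j / (i <= j)%N >-> j <= i} -> (0 < l)%N ->
  h ((n %/ l).+1 * l)%N <= h n <= h ((n %/ l) * l)%N.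
Proof.
move=> hd l0; apply/andP; split; apply: hd; last exact: leq_divM.
by rewrite ltnW// ltn_ceil.
Qed.

(** Each new factor adds one error [e], and earlier errors do not grow because they are multiplied
    by [h l <= 1]. *)
Lemma powers_approx (R : realType) (h : nat -> R) (l M : nat) (e : R) :
  0 <= e -> h 0%N = 1 -> 0 <= h l <= 1 ->
  (forall p q, (p + q <= M)%N -> `|h (p + q)%N - h p * h q| <= e) ->
  forall j, (j * l <= M)%N -> `|h (j * l)%N - h l ^+ j| <= j%:R * e.
Proof.
move=> e0 h0 /andP[a0 a1] hm; elim=> [|j ih] jM.
  by rewrite mul0n h0 expr0 subrr normr0 mul0r.
have {}ih : `|h (j * l)%N - h l ^+ j| <= j%:R * e by apply: ih; nia.
rewrite mulSn addnC exprSr.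
have := hm (j * l)%N l; rewrite (_ : (j * l + l)%N = (j.+1 * l)%N); last by lia.
move=> /(_ jM).
have -> : h (j.+1 * l)%N - h l ^+ j * h l =
   (h (j.+1 * l)%N - h (j * l)%N * h l) + (h (j * l)%N - h l ^+ j) * h l.
  by ring.
move=> he; apply: (le_trans (ler_normD _ _)).
rewrite -natr1 [leRHS]mulrDl mul1r [leRHS]addrC.
apply: lerD => //; rewrite normrM (ger0_norm a0).
by rewrite (le_trans _ ih)// ler_piMr.
Qed.

(** The tolerance is tuned so that [k * e] and [(k + 1) * e] are 1/e (Euler) times 1/(k+1) and 1/k.
    The bounds then become a^k >= e^(-1)/(1 + 1/k) >= e^(-1-1/k) and a^(k+1) <= e^(-1)(1 + 1/k) <=
    e^(-1+1/k), and logarithms give both estimates of [t]. *)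
Lemma rate_bounds (R : realType) (k : nat) (a e : R) : (0 < k)%N ->
  0 <= a <= 1 -> e = expR (-1) / (k%:R * k.+1%:R) ->
  expR (-1) <= a ^+ k + k%:R * e -> a ^+ k.+1 <= expR (-1) + k.+1%:R * e ->
  exists2 t : R, a = expR (- t) &
    [/\ 0 <= t, k%:R * t <= 1 + k%:R^-1 & 1 - k%:R^-1 <= k.+1%:R * t].
Proof.
move=> k0 /andP[a0 a1] eE lo hi.
have kp : 0 < k%:R :> R by rewrite ltr0n.
have kp1 : 0 < k.+1%:R :> R by rewrite ltr0n.
have g0 := expR_gt0 (-1 : R).
have ke : k%:R * e = expR (-1) / k.+1%:R
  by rewrite eE; field; apply/andP; split; lra.
have k1e : k.+1%:R * e = expR (-1) / k%:R
  by rewrite eE; field; apply/andP; split; lra.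
have i1 : k.+1%:R^-1 < 1 :> R by rewrite invf_lt1// ltr1n.
have {}lo : expR (-1) * (1 - k.+1%:R^-1) <= a ^+ k.
  by move: lo; rewrite ke mulrBr mulr1 lerBlDr.
have ap : 0 < a.
  rewrite lt_neqAle a0 andbT; apply/eqP => aE; move: lo.
  by rewrite -aE expr0n eqn0Ngt k0/= leNgt mulr_gt0// subr_gt0.
exists (- ln a); first by rewrite opprK lnK.
have aE : a = expR (ln a) by rewrite lnK.
split.
- by rewrite oppr_ge0 ln_le0.
- have : expR (-1 - k%:R^-1) <= a ^+ k.
    apply: le_trans lo; rewrite expRD ler_pM2l// expRN.
    rewrite (_ : 1 - k.+1%:R^-1 = (1 + k%:R^-1)^-1 :> R).
      have kV : 0 < 1 + k%:R^-1 :> R by rewrite addr_gt0// invr_gt0.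
      by rewrite lef_pV2 ?posrE ?expR_gt0// expR_ge1Dx.
    rewrite -natr1; field.
    by rewrite natr1 ?gt_eqF.
  by rewrite {1}aE -expRM_natl ler_expR; lra.
- have : a ^+ k.+1 <= expR (-1 + k%:R^-1).
    apply: (le_trans hi); rewrite k1e expRD.
    have := expR_ge1Dx (k%:R^-1 : R); nra.
  by rewrite {1}aE -expRM_natl ler_expR; lra.
Qed.

(** The two middle bounds amount to j/(k+1) <= i/m <= (j+1)/k. The outer ones limit the number of
    accumulated errors and keep [j.+1 * l] within the range where multiplicativity is assumed. *)
Lemma block_counting (k l m i j J : nat) : (0 < l)%N ->
  (l * k <= m)%N -> (l <= m < k.+1 * l)%N -> (i <= J * m)%N ->
  (j * l <= i < j.+1 * l)%N ->
  [/\ (j <= J * k.+1)%N, (j * m <= i * k.+1)%N, (i * k <= j.+1 * m)%N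
    & (j.+1 * l <= (2 * J + 1) * m)%N].
Proof.
move=> l0 lk /andP[lm /ltnW mk] iJ /andP[ji /ltnW ij]; split.
- rewrite -(leq_pmul2r l0) (leq_trans ji)// (leq_trans iJ)// -mulnA.
  by rewrite leq_mul2l mk orbT.
- rewrite (@leq_trans (j * (k.+1 * l))) ?leq_mul2l ?mk ?orbT//.
  by rewrite mulnCA mulnC leq_mul2r ji orbT.
- rewrite (@leq_trans (j.+1 * l * k)) ?leq_mul2r ?ij ?orbT//.
  by rewrite -mulnA leq_mul2l lk orbT.
- by rewrite mulSn mulnDl mul1n addnC leq_add// (leq_trans ji)// (leq_trans iJ)//
     leq_mul2r leq_pmull// orbT.
Qed.

(* With l = m %/ k the values at the multiples of l are nearly the powers of
   h l, and h m ~ expR (-1) forces h l ~ expR (- k^-1). *)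
Lemma multiplicative_approx (R : realType) (e0 : R) : 0 < e0 ->
  exists (K N : nat) (e : R), 0 < e /\ forall (h : nat -> R) (m : nat),
    (forall n, 0 <= h n) -> h 0%N = 1 ->
    {homo h : i j / (i <= j)%N >-> j <= i} -> (N <= m)%N ->
    expR (-1) < h m -> h m.+1 <= expR (-1) ->
    (forall p q, (p + q <= K * m)%N -> `|h (p + q)%N - h p * h q| <= e) ->
  forall n, `|h n - expR (- (n%:R / m%:R))| <= e0.
Proof.
move=> e00.
(* Past [J * m] monotonicity suffices, since e^(-J) <= 1/(1+J) <= e0/2. The accumulated error before
   that point will be at most (6+6J)/k, which dictates [k]. *)
have [J [J0 J2]] : exists J, (0 < J)%N /\ 2 / e0 < J%:R.
  by exists (Num.truncn (2 / e0)).+1; split=> //; exact: truncnS_gt.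
have [k [k0 kJ]] : exists k, (0 < k)%N /\ (6 + 6 * J%:R) / (e0 / 2) < k%:R.
  exists (Num.truncn ((6 + 6 * J%:R) / (e0 / 2))).+1; split=> //.
  exact: truncnS_gt.
have kp : 0 < k%:R :> R by rewrite ltr0n.
have kp1 : 0 < k.+1%:R :> R by rewrite ltr0n.
have g0 := expR_gt0 (-1 : R).
(* [m >= k * k] gives [l >= k], hence [m < k.+1 * l]. The factor [2 * J + 1] leaves room for the
   first multiple of [l] above [J * m] and for [k.+1 * l <= 2 * m]. *)
exists (2 * J + 1)%N, (k * k)%N, (expR (-1) / (k%:R * k.+1%:R)).
set e := expR (-1) / _.
have ep : 0 < e by rewrite divr_gt0// mulr_gt0.
have eE : k%:R * k.+1%:R * e = expR (-1).
  by rewrite /e mulrC divfK// mulf_neq0// gt_eqF.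
split=> // h m h_ge0 h0 hd km hm hm1 hmul n.
have hle1 i : h i <= 1 by rewrite -h0 hd.
have m0 : (0 < m)%N by rewrite (leq_trans _ km)// muln_gt0 k0.
pose l := (m %/ k)%N.
have kl : (l * k <= m)%N by exact: leq_divM.
have klS : (m < l.+1 * k)%N by rewrite ltn_ceil.
have l0 : (0 < l)%N by rewrite divn_gt0// (leq_trans _ km)// leq_pmull.
have lk : (k <= l)%N by rewrite leq_divRL.
have mk1 : (m < k.+1 * l)%N.
  by rewrite (leq_trans klS)// !mulSn (mulnC l) leq_add2r.
have lm : (l <= m)%N by exact: leq_div.
have pw j : (j * l <= (2 * J + 1) * m)%N -> `|h (j * l)%N - h l ^+ j| <= j%:R * e.
  by apply: powers_approx => //; [exact: ltW|rewrite h_ge0 hle1].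
have [t aE [t0 tu tl]] : exists2 t : R, h l = expR (- t) &
    [/\ 0 <= t, k%:R * t <= 1 + k%:R^-1 & 1 - k%:R^-1 <= k.+1%:R * t].
  apply: (@rate_bounds _ _ _ e) => //.
  - by rewrite h_ge0 hle1.
  - have /ler_normlP[_] : `|h (k * l)%N - h l ^+ k| <= k%:R * e.
      by apply: pw; rewrite mulnC (leq_trans kl)// leq_pmull// addn1.
    have : h m <= h (k * l)%N by apply: hd; rewrite mulnC.
    lra.
  - have /ler_normlP[+ _] : `|h (k.+1 * l)%N - h l ^+ k.+1| <= k.+1%:R * e.
      apply: pw; rewrite mulSn mulnC (leq_trans (leq_add lm kl))// addnn -mul2n.
      by rewrite leq_pmul2r// addn1 ltnS muln_gt0.
    have : h (k.+1 * l)%N <= h m.+1 by apply: hd.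
    lra.
have mp : 0 < m%:R :> R by rewrite ltr0n.
have g1 : expR (-1) <= 1 :> R by rewrite -[leRHS]expR0 ler_expR; lra.
pose q : R := k%:R^-1; have q0 : 0 < q by rewrite invr_gt0.
have kq : k%:R * q = 1 by rewrite mulfV// gt_eqF.
have q1 : q <= 1 by rewrite invf_le1// ler1n.
have th : t <= q + q ^+ 2.
  rewrite -(ler_pM2l kp) (le_trans tu)// -/q mulrDr kq.
  by rewrite expr2 mulrA kq mul1r.
have tl' : q - 2 * q ^+ 2 <= t.
  rewrite -(ler_pM2l kp1) (le_trans _ tl)// -/q -natr1.
  have -> : (k%:R + 1) * (q - 2 * q ^+ 2) =
    k%:R * q + q - 2 * (k%:R * q) * q - 2 * q ^+ 2 by ring.
  by rewrite kq; have := sqr_ge0 q; lra.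
have k1q : q - q ^+ 2 <= k.+1%:R^-1.
  rewrite -div1r ler_pdivlMr// -natr1.
  have -> : (q - q ^+ 2) * (k%:R + 1) =
    k%:R * q + q - (k%:R * q) * q - q ^+ 2 by ring.
  by rewrite kq; have := sqr_ge0 q; lra.
have eq2 : e <= q ^+ 2.
  rewrite -(ler_pM2l (mulr_gt0 kp kp)) [q ^+ 2]expr2 (mulrACA _ _ q) kq mulr1.
  by rewrite (le_trans _ g1)// -eE ler_pM2r// ler_pM2l// ler_nat.
(* [t] differs from [q] = 1/k by O(q^2), and there are at most J(k+1) factors, so the total
   discrepancy in the exponent is O(J q). *)
have bnd i : (i <= J * m)%N -> `|h i - expR (- (i%:R / m%:R))| <= e0 / 2.
  move=> iJ; have /andP[lo hi] := @nonincreasing_sandwich _ h l i hd l0.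
  set j := (i %/ l)%N in lo hi *.
  have jl : (j * l <= i)%N by exact: leq_divM.
  have jlS : (i < j.+1 * l)%N by rewrite ltn_ceil.
  have [jJ jm ik jK] : [/\ (j <= J * k.+1)%N, (j * m <= i * k.+1)%N,
      (i * k <= j.+1 * m)%N & (j.+1 * l <= (2 * J + 1) * m)%N].
    by apply: (@block_counting k l) => //; rewrite ?jl ?lm.
  have /ler_normlP[p1 p1'] : `|h (j * l)%N - h l ^+ j| <= j%:R * e.
    by apply: pw; apply: leq_trans jK; rewrite leq_mul2r leqnSn orbT.
  have /ler_normlP[p2 p2'] : `|h (j.+1 * l)%N - h l ^+ j.+1| <= j.+1%:R * e.
    exact: pw.
  have xlo : j%:R / k.+1%:R <= i%:R / m%:R :> R.
    by rewrite ler_pdivrMr// mulrAC ler_pdivlMr// -!natrM ler_nat.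
  have xhi : i%:R / m%:R <= j.+1%:R / k%:R :> R.
    by rewrite ler_pdivrMr// mulrAC ler_pdivlMr// -!natrM ler_nat.
  have jJR : j%:R <= J%:R * k.+1%:R :> R by rewrite -natrM ler_nat.
  have jq : j%:R * q ^+ 2 <= 2 * J%:R * q.
    apply: (@le_trans _ _ (J%:R * k.+1%:R * q ^+ 2)).
      by rewrite ler_wpM2r// sqr_ge0.
    have -> : J%:R * k.+1%:R * q ^+ 2 = J%:R * (k%:R * q * q + q * q).
      by rewrite -natr1; ring.
    rewrite kq mul1r (mulrC 2) -mulrA ler_wpM2l// mulr2n mulrDl mul1r lerD2l.
    by rewrite ler_piMr// ltW.
  have lip : `|expR (- (j%:R * t)) - expR (- (i%:R / m%:R))| <=
      `|j%:R * t - i%:R / m%:R|.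
    by apply: expR_lipschitz; rewrite ?mulr_ge0// divr_ge0.
  have {lip} lip : `|expR (- (j%:R * t)) - expR (- (i%:R / m%:R))| <=
      (1 + 4 * J%:R) * q.
    have x1 : j%:R * (q - q ^+ 2) <= i%:R / m%:R.
      by apply: le_trans xlo; exact: ler_wpM2l.
    have x2 : j.+1%:R / k%:R = j%:R * q + q by rewrite -natr1 mulrDl mul1r.
    have x3 : j%:R * t <= j%:R * (q + q ^+ 2) by exact: ler_wpM2l.
    have x4 : j%:R * (q - 2 * q ^+ 2) <= j%:R * t by exact: ler_wpM2l.
    rewrite x2 in xhi; rewrite (le_trans lip)//.
    move: (i%:R / m%:R) xhi x1 => x xhi x1.
    by rewrite ler_norml; apply/andP; split; lra.
  have je : j.+1%:R * e <= (1 + 2 * J%:R) * q.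
    rewrite -natr1.
    have : j%:R * e <= j%:R * q ^+ 2 by exact: ler_wpM2l.
    have : q ^+ 2 <= q by rewrite expr2 ler_piMr// ltW.
    lra.
  have fin : (6 + 6 * J%:R) * q <= e0 / 2.
    rewrite -(ler_pM2l kp) mulrCA kq mulr1.
    by move/ltW: kJ; rewrite ler_pdivrMr ?divr_gt0// mulrC.
  have powj : h l ^+ j = expR (- (j%:R * t)) by rewrite {1}aE -expRM_natl mulrN.
  have powj1 : h l ^+ j - t <= h l ^+ j.+1.
    rewrite exprS; have := expR_ge1Dx (- t); rewrite -aE => ?.
    have : 0 <= h l ^+ j <= 1 by rewrite exprn_ge0//= exprn_ile1.
    nra.
  move: lip => /ler_normlP[]; rewrite -powj => l1 l2.
  have : j%:R * e <= j.+1%:R * e by rewrite ler_pM2r// ler_nat.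
  move=> ?; rewrite ler_norml.
  have := sqr_ge0 q; have : q ^+ 2 <= q by rewrite expr2 ler_piMr// ltW.
  by move=> ? ?; apply/andP; split; lra.
case: (leqP n (J * m)) => nJ; first by apply: (le_trans (bnd _ nJ)); lra.
have /ler_normlP[b1 b2] := bnd _ (leqnn (J * m)).
have hn : h n <= h (J * m)%N by apply/hd/ltnW.
have Jm : (J * m)%:R / m%:R = J%:R :> R.
  by rewrite natrM mulfK// gt_eqF.
have eJ : expR (- J%:R) <= e0 / 2.
  rewrite expRN -[leRHS]invrK lef_pV2 ?posrE ?expR_gt0 ?invr_gt0 ?divr_gt0//.
  have := expR_ge1Dx (J%:R : R); rewrite invf_div; lra.
have en : expR (- (n%:R / m%:R)) <= expR (- J%:R) :> R.
  by rewrite ler_expR lerN2 -Jm ler_pM2r ?invr_gt0// ler_nat ltnW.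
rewrite Jm in b2; have := h_ge0 n; have := expR_gt0 (- (n%:R / m%:R) : R).
by move=> ? ?; rewrite ler_norml; apply/andP; split; lra.
Qed.

(** * Consequences of asymptotic independence of blocks *)

Definition survival (R : realType) (h : nat -> R) : Prop :=
  [/\ h 0%N = 1, forall n, 0 <= h n & {homo h : i j / (i <= j)%N >-> j <= i}].

(* [h u n] stands for P(M_n <= u); [h u p * h u q] is compared with the
   probability that neither of two blocks of lengths p and q, separated by a gap
   of length r, exceeds u. *)
Definition block_mixing (R : realType) (U : Type) (h : U -> nat -> R) : Prop :=
  forall (c : nat) (e : R), 0 < e -> exists N, forall r, (N <= r)%N ->
  forall u p q, (p + q <= c * r)%N ->
    h u (p + r + q)%N <= h u p * h u q + e /\
    h u p * h u q <= h u (p + r + q)%N + (1 - h u r) + e.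

Lemma survival_le1 (R : realType) (h : nat -> R) n : survival h -> h n <= 1.
Proof. by case=> h0 _ hd; rewrite -h0 hd. Qed.

Lemma expRN_small (R : realType) (c e : R) : 0 < c -> 0 < e ->
  exists N, forall n, (N <= n)%N -> expR (- (c * n%:R)) <= e.
Proof.
move=> c0 e0; exists (Num.truncn (e^-1 / c)).+1 => n Nn.
have : e^-1 / c < n%:R by rewrite (lt_le_trans (truncnS_gt _))// ler_nat.
rewrite ltr_pdivrMr// mulrC => en.
rewrite expRN -[leRHS]invrK lef_pV2 ?posrE ?expR_gt0 ?invr_gt0//.
by have := expR_ge1Dx (c * n%:R); lra.
Qed.

(** A stretch of length [(2 * j + 1) * r] holds [j + 1] blocks of length [r] separated by [j] gaps
    of length [r]. Only the upper half of mixing enters, so there is no loss from the gaps. *)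
Lemma block_power (R : realType) (h : nat -> R) (c r : nat) (e : R) :
  survival h -> 0 <= e ->
  (forall p q, (p + q <= c * r)%N -> h (p + r + q)%N <= h p * h q + e) ->
  forall j, (2 * j <= c)%N -> h ((2 * j + 1) * r)%N <= h r ^+ j.+1 + j%:R * e.
Proof.
move=> sh e0 hm; have [_ hp _] := sh; have hr := survival_le1 r sh.
elim=> [|j ih] jc; first by rewrite muln0 add0n mul1n expr1 mul0r addr0.
have {}ih : h ((2 * j + 1) * r)%N <= h r ^+ j.+1 + j%:R * e by apply: ih; lia.
have -> : ((2 * j.+1 + 1) * r = (2 * j + 1) * r + r + r)%N by lia.
apply: (le_trans (hm _ _ _)).
  by rewrite -mulSnr leq_mul2r; apply/orP; right; lia.
rewrite exprSr -natr1; have := hp r.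
have : 0 <= j%:R * e by rewrite mulr_ge0.
nra.
Qed.

(** Otherwise [j + 1] separated blocks of length [m %/ L], with [L] = 2j+1, would give h u m <=
    (1-e)^(j+1) plus a mixing error. Each of the two is made at most a quarter of 1/e (Euler),
    contradicting the lower bound on [h u m]. [L] depends on [e] only. *)
Lemma short_blocks_near1 (R : realType) (U : Type) (h : U -> nat -> R) (e : R) :
  (forall u, survival (h u)) -> block_mixing h -> 0 < e ->
  exists L N, (0 < L)%N /\ forall m, (N <= m)%N -> forall u,
    expR (-1) <= h u m -> 1 - e <= h u (m %/ L)%N.
Proof.
move=> sh hmix e0; have g0 := expR_gt0 (-1 : R).
have [j hj] : exists N, forall n, (N <= n)%N -> expR (- (e * n%:R)) <= expR (-1) / 4.
  by apply: expRN_small => //; rewrite divr_gt0.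
have j0 : 0 < j.+1%:R :> R by rewrite ltr0n.
have [N hN] := hmix (2 * j)%N (expR (-1) / 4 / j.+1%:R) ltac:(by rewrite !divr_gt0).
exists (2 * j + 1)%N, (N * (2 * j + 1))%N; split; first by rewrite addn1.
move=> m Nm u gm; rewrite leNgt; apply/negP => hlt.
set r := (m %/ (2 * j + 1))%N in hlt.
have Nr : (N <= r)%N by rewrite /r leq_divRL// addn1.
have /block_power : survival (h u) by [].
move=> /(_ (2 * j)%N r (expR (-1) / 4 / j.+1%:R) ltac:(by rewrite !divr_ge0)).
move=> /(_ (fun p q pq => (hN _ Nr u p q pq).1) j (leqnn _)).
have : h u m <= h u ((2 * j + 1) * r)%N.
  by case: (sh u) => _ _; apply; rewrite mulnC leq_divM.
have : j%:R * (expR (-1) / 4 / j.+1%:R) <= expR (-1) / 4 :> R.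
  by rewrite mulrCA ler_piMr ?divr_ge0 ?expR_ge0// ler_pdivrMr// mul1r ler_nat.
have : h u r ^+ j.+1 <= expR (-1) / 4.
  apply: le_trans (hj j.+1 (leqnSn _)); rewrite mulrC -mulrN expRM_natl.
  apply: lerXn2r; rewrite ?nnegrE ?expR_ge0//; first by case: (sh u).
  by have := expR_ge1Dx (- e); lra.
move: (j%:R * _) => x; lra.
Qed.

Lemma asymptotic_multiplicativity (R : realType) (U : Type) (h : U -> nat -> R)
    (K : nat) (e : R) :
  (forall u, survival (h u)) -> block_mixing h -> 0 < e ->
  exists N, forall m, (N <= m)%N -> forall u, expR (-1) <= h u m ->
  forall p q, (p + q <= K * m)%N -> `|h u (p + q)%N - h u p * h u q| <= e.
Proof.
move=> sh hmix e0; have e20 : 0 < e / 3 by rewrite divr_gt0.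
have [L [N [L0 hL]]] := short_blocks_near1 sh hmix e20.
have [N' hN'] := hmix (K * (2 * L))%N _ e20.
(* This forces [r = m %/ L] to be positive, so that [m <= 2 * L * r] and [p + q <= K * m] is bounded
   by a fixed multiple of [r]. *)
exists (maxn N (N'.+1 * L)%N) => m; rewrite geq_max => /andP[Nm N'm] u gm p q pq.
have hr := hL _ Nm _ gm; set r := (m %/ L)%N in hr.
have N'r : (N' < r)%N by rewrite /r leq_divRL.
have mr : (m <= 2 * L * r)%N.
  have : (m < r.+1 * L)%N by rewrite ltn_ceil.
  have : (r.+1 * L <= 2 * r * L)%N by rewrite leq_mul2r; apply/orP; right; lia.
  by rewrite (_ : 2 * r * L = 2 * L * r)%N; lia.
have [h0 hp hd] := sh u; have hle1 i := survival_le1 i (sh u).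
have cK : (K * m <= K * (2 * L) * r)%N by rewrite -mulnA leq_mul2l mr orbT.
have gap i : (i <= K * m)%N -> h u i <= h u (i + r)%N + 2 * (e / 3).
  move=> iK.
  have := (hN' r (ltnW N'r) u i 0%N ltac:(by rewrite addn0 (leq_trans iK cK))).2.
  by rewrite addn0 h0 mulr1; lra.
have := hp p; have := hle1 p; have := hp q; have := hle1 q => q1 q0 p1 p0.
(* If [q >= r], the gap is carved out of the second block. If [q < r], the second block is almost
   sure because [h u q >= h u r], and both quantities are close to [h u p]. *)
case: (leqP r q) => rq.
  have [s1 s2] := hN' r (ltnW N'r) u p (q - r)%N
    (leq_trans (leq_add (leqnn p) (leq_subr r q)) (leq_trans pq cK)).
  rewrite -addnA subnKC// in s1 s2.
  have := gap (q - r)%N (leq_trans (leq_subr r q) (leq_trans (leq_addl p q) pq)).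
  rewrite subnK// => hqr.
  have hqr' : h u q <= h u (q - r)%N by apply/hd/leq_subr.
  by rewrite ler_norml; apply/andP; split; nra.
have hq : h u r <= h u q by apply/hd/ltnW.
have hpq : h u (p + q)%N <= h u p by apply/hd/leq_addr.
have hpr : h u (p + r)%N <= h u (p + q)%N by apply: hd; rewrite leq_add2l ltnW.
have hgp := gap p (leq_trans (leq_addr q p) pq).
by rewrite ler_norml; apply/andP; split; nra.
Qed.

(** Serves the levels whose crossing of 1/e happens before a fixed [n0]: blocks longer than [n0]
    each contribute a factor at most 1/e, and their number is chosen from [e] alone. *)
Lemma uniform_decay (R : realType) (U : Type) (h : U -> nat -> R) (n0 : nat) (e : R) :
  (forall u, survival (h u)) -> block_mixing h -> 0 < e ->
  exists N, forall u, h u n0 <= expR (-1) ->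
  forall n, (N <= n)%N -> h u n <= e.
Proof.
move=> sh hmix e0; have e20 : 0 < e / 2 by rewrite divr_gt0.
have [j hj] := @expRN_small R 1 _ ltr01 e20.
have j0 : 0 < j.+1%:R :> R by rewrite ltr0n.
have e30 : 0 < e / 2 / j.+1%:R by rewrite divr_gt0.
have [N hN] := hmix (2 * j)%N _ e30.
pose r := maxn N n0; exists ((2 * j + 1) * r)%N => u hu n rn.
have [_ hp hd] := sh u.
apply: (le_trans (hd _ _ rn)).
have hNr : (N <= r)%N by exact: leq_maxl.
apply: (le_trans (block_power (sh u) (ltW e30)
  (fun p q pq => (hN r hNr u p q pq).1) (leqnn _))).
have : j%:R * (e / 2 / j.+1%:R) <= e / 2.
  by rewrite mulrCA ler_piMr ?(ltW e20)// ler_pdivrMr// mul1r ler_nat.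
have : h u r ^+ j.+1 <= e / 2.
  apply: le_trans (hj j.+1 (leqnSn _)); rewrite mul1r -mulrN1 expRM_natl.
  apply: lerXn2r; rewrite ?nnegrE ?expR_ge0// (le_trans _ hu)// hd// leq_maxr//.
move: (j%:R * _) => x; lra.
Qed.

(** With no crossing, [short_blocks_near1] applies at arbitrarily large [m], so that [m %/ L]
    exceeds any given [n]. *)
Lemma survival_const1 (R : realType) (U : Type) (h : U -> nat -> R) (u : U) :
  (forall u, survival (h u)) -> block_mixing h ->
  (forall n, expR (-1) < h u n) -> forall n, h u n = 1.
Proof.
move=> sh hmix hu n; apply/eqP; rewrite eq_le survival_le1//=.
apply/ler_addgt0Pr => e e0.
have [L [N [L0 hL]]] := short_blocks_near1 sh hmix e0.
have := hL (N + n * L)%N (leq_addr _ _) u (ltW (hu _)).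
have : h u ((N + n * L) %/ L)%N <= h u n.
  by case: (sh u) => _ _; apply; rewrite addnC divnMDl// leq_addr.
lra.
Qed.

Lemma survival_exp_approx (R : realType) (U : Type) (h : U -> nat -> R) (e : R) :
  (forall u, survival (h u)) -> block_mixing h -> 0 < e ->
  exists N, forall m, (N <= m)%N ->
  forall u, expR (-1) < h u m -> h u m.+1 <= expR (-1) ->
  forall n, `|h u n - expR (- (n%:R / m%:R))| <= e.
Proof.
move=> sh hmix e0; have [K [N [e' [e'0 hD]]]] := multiplicative_approx e0.
have [N' hN'] := asymptotic_multiplicativity K sh hmix e'0.
exists (maxn N N') => m; rewrite geq_max => /andP[Nm N'm] u hm hm1.
have [h0 hp hd] := sh u.
by apply: hD => //; apply: hN' => //; exact: ltW.
Qed.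

(** * The phantom distribution function *)

Definition clamp01 (R : realType) (x : R) : R := Num.min 1 (Num.max 0 x).

Lemma clamp01_itv (R : realType) (x : R) : 0 <= clamp01 x <= 1.
Proof. by rewrite le_min ler01 ge_min lexx le_max lexx. Qed.

Lemma clamp01_le0 (R : realType) (x : R) : x <= 0 -> clamp01 x = 0.
Proof. by move=> x0; rewrite /clamp01 (max_idPl x0)// min_r. Qed.

Lemma clamp01_ge1 (R : realType) (x : R) : 1 <= x -> clamp01 x = 1.
Proof. by move=> x1; rewrite /clamp01 min_l// le_max x1 orbT. Qed.

Lemma clamp01_homo (R : realType) : {homo @clamp01 R : x y / x <= y}.
Proof. by move=> x y xy; rewrite /clamp01 le_min2// le_max2. Qed.

Lemma clamp01_lipschitz (R : realType) (x y : R) :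
  `|clamp01 x - clamp01 y| <= `|x - y|.
Proof.
wlog le_xy : x y / x <= y => [hw|].
  by case: (leP x y) => [/hw//|/ltW /hw]; rewrite distrC (distrC x).
rewrite distrC (distrC x) !ger0_norm ?subr_ge0 ?clamp01_homo//.
rewrite /clamp01 !minEle !maxEle.
by case: (leP 0 x) => ?; case: (leP 0 y) => ?; case: (leP 1 x) => ?;
  case: (leP 1 y) => ?; rewrite ?ler10; lra.
Qed.

(* G(u) = sup_n e^(-1/n) 1{H_n(u) > 1/e}, up to a smoothing of the indicator that
   becomes sharp as n grows and makes G continuous. Since H_n(u) ~ e^(-n/m) for
   some m, the supremum is close to e^(-1/m). *)
Definition phantom_term (R : realType) (U : Type) (h : U -> nat -> R) (n : nat)
    (u : U) : R :=
  expR (- n.+1%:R^-1) * clamp01 (n.+1%:R * (h u n.+1 - expR (-1))).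

Definition phantom (R : realType) (U : Type) (h : U -> nat -> R) (u : U) : R :=
  sup (range (phantom_term h ^~ u)).

Section phantom_theory.
Context (R : realType) (U : Type) (h : U -> nat -> R).

Lemma phantom_term_itv n u : 0 <= phantom_term h n u <= expR (- n.+1%:R^-1).
Proof.
have /andP[c0 c1] := clamp01_itv (n.+1%:R * (h u n.+1 - expR (-1))).
by rewrite mulr_ge0 ?expR_ge0//= ler_piMr ?expR_ge0.
Qed.

Lemma phantom_term_le1 n u : phantom_term h n u <= 1.
Proof.
have /andP[_ /le_trans] := phantom_term_itv n u; apply.
by rewrite -expR0 ler_expR oppr_le0 invr_ge0.
Qed.

Lemma phantom_term0 n u : h u n.+1 <= expR (-1) -> phantom_term h n u = 0.
Proof.
by move=> hu; rewrite /phantom_term clamp01_le0 ?mulr0// mulr_ge0_le0// subr_le0.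
Qed.

Lemma phantom_has_sup u : has_sup (range (phantom_term h ^~ u)).
Proof.
split; first by exists (phantom_term h 0 u), 0%N.
by exists 1 => _ [n _ <-]; exact: phantom_term_le1.
Qed.

Lemma phantom_term_le n u : phantom_term h n u <= phantom h u.
Proof. by apply: (sup_upper_bound (phantom_has_sup u)); exists n. Qed.

Lemma phantom_ub u c : (forall n, phantom_term h n u <= c) -> phantom h u <= c.
Proof.
move=> hc; apply: ge_sup; first by case: (phantom_has_sup u).
by move=> _ [n _ <-].
Qed.

Lemma phantom_itv u : 0 <= phantom h u <= 1.
Proof.
apply/andP; split; last by apply: phantom_ub => n; exact: phantom_term_le1.
by apply: le_trans (phantom_term_le 0 u); case/andP: (phantom_term_itv 0 u).
Qed.

(** The term of index [n] looks at length [n.+1], so all terms with [n >= m] vanish and the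
    remaining ones have n+1 <= m. *)
Lemma phantom_le_expR u m : {homo h u : i j / (i <= j)%N >-> j <= i} ->
  h u m.+1 <= expR (-1) -> phantom h u <= expR (- m%:R^-1).
Proof.
move=> hd hm; apply: phantom_ub => n; have [mn|nm] := leqP m n.
  by rewrite phantom_term0 ?expR_ge0// (le_trans _ hm)// hd.
have /andP[_ /le_trans] := phantom_term_itv n u; apply.
rewrite ler_expR lerN2 lef_pV2 ?posrE ?ltr0n ?ler_nat//; exact: leq_trans nm.
Qed.

Lemma expR_le_phantom_term u n : 1 <= n.+1%:R * (h u n.+1 - expR (-1)) ->
  expR (- n.+1%:R^-1) <= phantom_term h n u.
Proof. by move=> hn; rewrite /phantom_term clamp01_ge1// mulr1. Qed.

Lemma phantom_term_lipschitz n u v :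
  `|phantom_term h n u - phantom_term h n v| <= n.+1%:R * `|h u n.+1 - h v n.+1|.
Proof.
rewrite -mulrBr normrM (ger0_norm (expR_ge0 _)).
have e1 : expR (- n.+1%:R^-1) <= 1 :> R.
  by rewrite -[leRHS]expR0 ler_expR oppr_le0 invr_ge0.
rewrite (le_trans (ler_piMl _ e1))// (le_trans (clamp01_lipschitz _ _))//.
by rewrite -mulrBr normrM ger0_norm// opprB addrA subrK.
Qed.

Lemma phantom_homo u v : (forall n, h u n <= h v n) -> phantom h u <= phantom h v.
Proof.
move=> uv; apply: phantom_ub => n; apply: le_trans (phantom_term_le n v).
by rewrite ler_wpM2l ?expR_ge0// clamp01_homo// ler_wpM2l// lerB.
Qed.

End phantom_theory.

Lemma expRN1_lt_half (R : realType) : expR (-1) <= 1 / 2 :> R.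
Proof.
rewrite expRN div1r lef_pV2 ?posrE ?expR_gt0//.
by have := expR_ge1Dx (1 : R); lra.
Qed.

Lemma expRNV_near1 (R : realType) (e : R) : 0 < e ->
  exists N, forall n, (N <= n)%N -> 1 - e <= expR (- n%:R^-1).
Proof.
move=> e0; exists (Num.truncn e^-1).+1 => n Nn.
have en : e^-1 < n%:R by rewrite (lt_le_trans (truncnS_gt _))// ler_nat.
have : n%:R^-1 <= e.
  rewrite -[leRHS]invrK lef_pV2 ?posrE ?invr_gt0 ?(ltW en)//.
  by rewrite (lt_trans _ en)// invr_gt0.
by have := expR_ge1Dx (- n%:R^-1 : R); lra.
Qed.

(* The terms beyond N matter only where h u N > 1/e, and there an earlier term is
   already close to 1. *)
Lemma phantom_tail (R : realType) (U : Type) (h : U -> nat -> R) (e : R) :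
  (forall u, survival (h u)) -> block_mixing h -> 0 < e ->
  exists N, forall u, (forall n, (N <= n)%N -> phantom_term h n u = 0) \/
    exists2 s, (s < N)%N & 1 - e <= phantom_term h s u.
Proof.
move=> sh hmix e0; have q0 : 0 < 1 / 4 :> R by rewrite divr_gt0.
have [L [N [L0 hL]]] := short_blocks_near1 sh hmix q0.
have [M hM] := expRNV_near1 e0.
(* [M] makes the exponential factor at least [1 - e]. The 4 saturates the clamp: [h u s.+1 >= 3/4]
   and 1/e <= 1/2 leave a margin of at least 1/4. *)
exists (N + (maxn M 4) * L)%N => u; set m := (N + _)%N.
have [gm|gm] := leP (expR (-1)) (h u m); last first.
  left=> n mn; apply: phantom_term0; apply: le_trans (ltW gm).
  by case: (sh u) => _ _; apply; rewrite ltnW.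
right; have hr := hL m (leq_addr _ _) u gm.
have rM : (maxn M 4 <= m %/ L)%N by rewrite /m addnC divnMDl// leq_addr.
have rm : (m %/ L <= m)%N by exact: leq_div.
move: (m %/ L)%N hr rM rm => [|s] hr; first by rewrite geq_max andbF.
rewrite geq_max => /andP[Ms s4] sm; exists s => //.
rewrite (le_trans (hM _ Ms))//; apply: expR_le_phantom_term.
have := expRN1_lt_half R; have : 4 <= s.+1%:R :> R by rewrite ler_nat.
nra.
Qed.

Lemma near_ltn (T : Type) (F : set_system T) (Q : nat -> T -> Prop) :
  Filter F -> (forall n, \forall x \near F, Q n x) ->
  forall N, \forall x \near F, forall n, (n < N)%N -> Q n x.
Proof.
move=> FF hQ; elim=> [|N ih]; first by apply: nearW.
apply: filterS2 ih (hQ N) => x ih QN n; rewrite ltnS leq_eqVlt => /predU1P[->//|].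
exact: ih.
Qed.

(** By [phantom_tail] the first [N] terms decide: either the others vanish, or one of the first [N]
    is already within [e / 2] of the upper bound 1. As [N] is the same at all points, nearby points
    can be compared in both directions. *)
Lemma phantom_continuous (R : realType) (U : topologicalType) (h : U -> nat -> R) :
  (forall u, survival (h u)) -> block_mixing h ->
  (forall n, continuous (h ^~ n)) -> continuous (phantom h).
Proof.
move=> sh hmix hc u; apply/cvgrPdist_le => /= e e0.
have e20 : 0 < e / 2 by rewrite divr_gt0.
have [N hN] := phantom_tail sh hmix e20.
have : \forall v \near nbhs u, forall n, (n < N)%N ->
    `|phantom_term h n u - phantom_term h n v| <= e / 2.
  apply: near_ltn => n.
  have := hc n.+1 u => /cvgrPdist_le /(_ (e / 2 / n.+1%:R)).
  move=> /(_ ltac:(by rewrite divr_gt0)); apply: filterS => v /= hv.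
  apply: (le_trans (phantom_term_lipschitz _ _ _ _)).
  by rewrite mulrC -ler_pdivlMr.
apply: filterS => v hv.
have half (x y : U) : (forall n, (n < N)%N ->
    `|phantom_term h n x - phantom_term h n y| <= e / 2) ->
    phantom h x <= phantom h y + e.
  move=> hxy; have [hx|[s sN hs]] := hN x.
    apply: phantom_ub => n; have [nN|nN] := leqP N n.
      have /andP[y0 _] := phantom_itv h y.
      by rewrite hx// addr_ge0// ltW.
    have /ler_normlP[_] := hxy _ nN; have := phantom_term_le h n y; lra.
  have /ler_normlP[_] := hxy _ sN; have := phantom_term_le h s y.
  by have /andP[_] := phantom_itv h x; lra.
have h1 := half u v hv.
have h2 : phantom h v <= phantom h u + e.
  by apply: half => n /hv; rewrite distrC.
by rewrite ler_norml; apply/andP; split; lra.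
Qed.

(** The loss is about x e^(-x) d, and x e^(-x) <= 1 makes it uniform in [x]. *)
Lemma expRN_stretch (R : realType) (x d : R) : 0 <= x -> 0 <= d ->
  expR (- x) - d <= expR (- (x * (1 + d))).
Proof.
move=> x0 d0.
have xe : x * expR (- x) <= 1.
  by rewrite expRN ler_pdivrMr ?expR_gt0// mul1r; have := expR_ge1Dx x; lra.
rewrite mulrDr mulr1 opprD expRD.
have : expR (- x) * (1 + - (x * d)) <= expR (- x) * expR (- (x * d)).
  by rewrite ler_pM2l ?expR_gt0// expR_ge1Dx.
nra.
Qed.

(** At length [m] the margin of [h u m] over 1/e may be too small to saturate the clamp. Stepping
    back by [l], about m/k, the exponential approximation yields a margin [e1], which saturates it
    once [m] is large. The price is the rate 1/(m-l) instead of 1/m, a stretch by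
    [l / (m - l) <= 2 / k < e]. *)
Lemma phantom_pow_ge (R : realType) (U : Type) (h : U -> nat -> R)
    (e : R) :
  (forall u, survival (h u)) -> block_mixing h -> 0 < e ->
  exists N, forall m, (N <= m)%N ->
  forall u, expR (-1) < h u m -> h u m.+1 <= expR (-1) ->
  forall n, expR (- (n%:R / m%:R)) - e <= phantom h u ^+ n.
Proof.
move=> sh hmix e0; have g0 := expR_gt0 (-1 : R).
have [k [k2 ke]] : exists k, (2 <= k)%N /\ 2 / e < k%:R.
  exists (Num.truncn (2 / e)).+2; split=> //.
  by rewrite (lt_trans (truncnS_gt _))// ltr_nat.
have kp : 0 < k%:R :> R by rewrite ltr0n (leq_trans _ k2).
pose e1 : R := expR (-1) / (4 * k%:R).
have e10 : 0 < e1 by rewrite divr_gt0// mulr_gt0.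
have [N hN] := survival_exp_approx sh hmix e10.
pose M := (Num.truncn (2 / e1)).+1.
exists (maxn N (maxn k M)) => m; rewrite !geq_max => /and3P[Nm km Mm] u hm hm1 n.
have k0 : (0 < k)%N by exact: leq_trans k2.
pose l := (m %/ k)%N.
have lk : (l * k <= m)%N by exact: leq_divM.
have l0 : (0 < l)%N by rewrite divn_gt0.
have ml : (m <= 2 * (l * k))%N.
  have : (m < l.+1 * k)%N by rewrite ltn_ceil.
  have : (k <= l * k)%N by rewrite leq_pmull.
  by rewrite (mulSn l); lia.
have l2 : (2 * l <= m)%N.
  by rewrite (leq_trans _ lk)// mulnC leq_mul2l k2 orbT.
have m0 : (0 < m)%N by lia.
have [s ms] : exists s, m = (s.+1 + l)%N.
  by exists (m - l).-1; rewrite prednK ?subn_gt0 ?subnK; lia.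
have mp : 0 < m%:R :> R by rewrite ltr0n.
have sp : 0 < s.+1%:R :> R by rewrite ltr0n.
have msR : m%:R = s.+1%:R + l%:R :> R by rewrite ms natrD.
have lkR : l%:R * k%:R <= m%:R :> R by rewrite -natrM ler_nat.
have mlR : m%:R <= 2 * (l%:R * k%:R) :> R by rewrite -!natrM ler_nat.
have l2R : 2 * l%:R <= m%:R :> R by rewrite -natrM ler_nat.
have smR : m%:R <= 2 * s.+1%:R :> R by lra.
have hs : expR (-1) + e1 <= h u s.+1.
  have /ler_normlP[+ _] := hN m Nm u hm hm1 s.+1.
  have lm : (2 * k%:R)^-1 <= l%:R / m%:R :> R.
    rewrite -div1r ler_pdivrMr ?mulr_gt0// mulrAC ler_pdivlMr// mul1r.
    by rewrite mulrCA.
  have -> : - (s.+1%:R / m%:R) = - 1 + l%:R / m%:R :> R.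
    have -> : s.+1%:R = m%:R - l%:R :> R by rewrite msR addrK.
    by rewrite mulrBl divff ?gt_eqF// opprB addrC.
  rewrite expRD => hs.
  have : expR (-1) * (1 + (2 * k%:R)^-1) <= expR (-1) * expR (l%:R / m%:R) :> R.
    by rewrite ler_pM2l//; have := expR_ge1Dx (l%:R / m%:R : R); lra.
  have -> : expR (-1) * (1 + (2 * k%:R)^-1) = expR (-1) + 2 * e1.
    by rewrite /e1; field; rewrite gt_eqF.
  lra.
have big : 1 <= s.+1%:R * (h u s.+1 - expR (-1)).
  have : 2 / e1 <= m%:R.
    by rewrite ltW// (lt_le_trans (truncnS_gt _))// ler_nat.
  rewrite ler_pdivrMr// => big.
  have : s.+1%:R * e1 <= s.+1%:R * (h u s.+1 - expR (-1)).
    by rewrite ler_pM2l//; lra.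
  nra.
have {big} := le_trans (expR_le_phantom_term big) (phantom_term_le h s u) => ps.
apply: (@le_trans _ _ (expR (- s.+1%:R^-1) ^+ n)); last first.
  by rewrite lerXn2r ?nnegrE ?expR_ge0//; case/andP: (phantom_itv h u).
rewrite -expRM_natl mulrN.
have d0 : 0 <= l%:R / s.+1%:R :> R by rewrite divr_ge0.
have x0 : 0 <= n%:R / m%:R :> R by rewrite divr_ge0.
have := expRN_stretch x0 d0.
have -> : n%:R / m%:R * (1 + l%:R / s.+1%:R) = n%:R / s.+1%:R :> R.
  have s0 : s.+1%:R != 0 :> R by rewrite gt_eqF.
  have m00 : m%:R != 0 :> R by rewrite gt_eqF.
  have -> : 1 + l%:R / s.+1%:R = m%:R / s.+1%:R :> R.
    by rewrite msR mulrDl divff.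
  by rewrite mulrA divfK.
apply: le_trans; rewrite lerD2l lerN2 ler_pdivrMr//.
move: ke; rewrite ltr_pdivrMr// => ke; nra.
Qed.

Lemma phantom_approx (R : realType) (U : Type) (h : U -> nat -> R) (e : R) :
  (forall u, survival (h u)) -> block_mixing h -> 0 < e ->
  exists N, forall n, (N <= n)%N -> forall u, `|h u n - phantom h u ^+ n| <= e.
Proof.
move=> sh hmix e0; have e20 : 0 < e / 2 by rewrite divr_gt0.
have [N1 hN1] := survival_exp_approx sh hmix e20.
have [N2 hN2] := phantom_pow_ge sh hmix e20.
pose N0 := (maxn N1 N2).+1.
have [N3 hN3] := uniform_decay N0 sh hmix e0.
have [N4 hN4] := @expRN_small R N0%:R^-1 e ltac:(by rewrite invr_gt0) e0.
exists (maxn N3 N4) => n; rewrite geq_max => /andP[N3n N4n] u.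
have [h0 hp hd] := sh u.
have /andP[G0 G1] := phantom_itv h u.
have [[i hi]|/forallNP hnot] := pselect (exists i, h u i <= expR (-1)); last first.
  have hu i : expR (-1) < h u i by rewrite ltNge; apply/negP/hnot.
  have h1 := survival_const1 sh hmix hu.
  suff -> : phantom h u = 1 by rewrite h1 expr1n subrr normr0 ltW.
  apply/eqP; rewrite eq_le G1/=; apply/ler_addgt0Pr => d d0.
  have [M hM] := expRNV_near1 d0.
  have := hM (maxn M 1).+1 ltac:(by rewrite (leq_trans (leq_maxl _ 1))).
  have : expR (- (maxn M 1).+1%:R^-1) <= phantom h u.
    apply: le_trans (phantom_term_le h (maxn M 1) u).
    apply: expR_le_phantom_term; rewrite h1.
    have := expRN1_lt_half R.
    have : 2 <= (maxn M 1).+1%:R :> R by rewrite ler_nat ltnS leq_maxr.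
    nra.
  lra.
have exi : exists i, h u i <= expR (-1) by exists i.
(* [m.+1] is the first length at which [h u] is at most 1/e. The value [m = 0] remains possible;
   then [m%:R^-1] is 0, the bounds [Gm] and [GmX] are trivial, and the case falls under [m < N0]. *)
case: (ex_minnP exi) => [[|m]] hm1 hmin.
  by have := expRN1_lt_half R; rewrite h0 in hm1; lra.
have hm : expR (-1) < h u m.
  by rewrite ltNge; apply/negP => /hmin; rewrite ltnn.
have Gm := phantom_le_expR hd hm1.
have GmX : phantom h u ^+ n <= expR (- (n%:R / m%:R)).
  by rewrite -mulrN expRM_natl lerXn2r ?nnegrE ?expR_ge0.
have [mN|Nm] := ltnP m N0.
  have hn : h u n <= e by apply: hN3 => //; rewrite (le_trans _ hm1)// hd.
  have : phantom h u ^+ n <= e.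
    apply: le_trans (hN4 _ N4n).
    rewrite mulrC -mulrN expRM_natl lerXn2r ?nnegrE ?expR_ge0//.
    rewrite (phantom_le_expR hd)// (le_trans _ hm1)// hd//.
    exact: leq_trans mN _.
  have := hp n; have : 0 <= phantom h u ^+ n by rewrite exprn_ge0.
  by move=> ? ? ?; rewrite ler_norml; apply/andP; split; lra.
have /ler_normlP[a1 a2] :=
  hN1 m (leq_trans (leq_trans (leq_maxl _ N2) (leqnSn _)) Nm) u hm hm1 n.
have := hN2 m (leq_trans (leq_trans (leq_maxr N1 _) (leqnSn _)) Nm) u hm hm1 n.
by move=> ?; rewrite ler_norml; apply/andP; split; lra.
Qed.

(** * Block events *)

Section fine_probability.
Context d (T : measurableType d) (R : realType) (P : probability T R).

Let pr (A : set T) : R := fine (P A).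

Let PE (A : set T) : measurable A -> P A = (pr A)%:E.
Proof. by move=> mA; rewrite /pr fineK// fin_num_measure. Qed.

Lemma fine_probability_itv (A : set T) : measurable A -> 0 <= fine (P A) <= 1.
Proof.
by move=> mA; rewrite fine_ge0//= -lee_fin -PE// probability_le1.
Qed.

Lemma fine_probability_le (A B : set T) : measurable A -> measurable B ->
  A `<=` B -> fine (P A) <= fine (P B).
Proof.
by move=> mA mB AB; rewrite -lee_fin -!PE// le_measure ?inE.
Qed.

Lemma fine_probabilityU (A B : set T) : measurable A -> measurable B ->
  fine (P (A `|` B)) <= fine (P A) + fine (P B).
Proof.
move=> mA mB; rewrite -lee_fin EFinD -!PE//; last exact: measurableU.
exact: measureU2.
Qed.

Lemma fine_probabilityD (A B : set T) : measurable A -> measurable B ->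
  A `<=` B -> fine (P (B `\` A)) = fine (P B) - fine (P A).
Proof.
move=> mA mB AB; apply: EFin_inj; rewrite EFinB -!PE//; last exact: measurableD.
rewrite measureD// ?(setIidr AB)//.
by rewrite ltey_eq fin_num_measure.
Qed.

(** Comes from the inclusion of B meet B' in the union of A meet A', B minus A and B' minus A'. It
    serves both for raising the level of a block and for union bounds. *)
Lemma fine_probabilityI_le (A A' B B' : set T) :
  measurable A -> measurable A' -> measurable B -> measurable B' ->
  A `<=` B -> A' `<=` B' ->
  fine (P (B `&` B')) <=
    fine (P (A `&` A')) + (fine (P B) - fine (P A)) + (fine (P B') - fine (P A')).
Proof.
move=> mA mA' mB mB' AB AB'; rewrite -!fine_probabilityD//.
have mI : measurable (A `&` A') by exact: measurableI.
have mD : measurable (B `\` A) by exact: measurableD.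
have mD' : measurable (B' `\` A') by exact: measurableD.
apply: (@le_trans _ _ (pr ((A `&` A') `|` (B `\` A) `|` (B' `\` A')))).
  apply: fine_probability_le; [exact: measurableI| |].
    by apply: measurableU => //; exact: measurableU.
  move=> x [Bx B'x]; have [Ax|Ax] := pselect (A x); last by left; right.
  by have [A'x|A'x] := pselect (A' x); [left; left|right].
rewrite (le_trans (fine_probabilityU _ _))//; first exact: measurableU.
by rewrite lerD2r fine_probabilityU.
Qed.

Lemma expectation_between_indic (A B : set T) (Y : T -> R) :
  measurable A -> measurable B -> measurable_fun [set: T] Y ->
  (forall w, \1_A w <= Y w <= \1_B w) ->
  Y \in Lfun P 1 /\ fine (P A) <= fine 'E_P[Y] <= fine (P B).
Proof.
move=> mA mB mY AYB.
have Y0 w : 0 <= Y w by have /andP[+ _] := AYB w; apply: le_trans; rewrite indicE.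
have Y1 w : Y w <= 1.
  by have /andP[_ /le_trans] := AYB w; apply; rewrite indicE lern1 leq_b1.
have LY : Y \in Lfun P 1.
  apply/Lfun1_integrable; apply: measurable_bounded_integrable => //.
    by rewrite ltey_eq fin_num_measure.
  exists 1; split=> // M M1 w _ /=; rewrite ger0_norm// (le_trans (Y1 w))//.
  exact: ltW.
split=> //; have fE := expectation_fin_num LY.
have EA : (P A <= 'E_P[Y])%E.
  rewrite -(expectation_indic P mA); apply: expectation_le => //.
    by apply/aeW => w; case/andP: (AYB w).
have EB : ('E_P[Y] <= P B)%E.
  rewrite -(expectation_indic P mB); apply: expectation_le => //.
    by apply/aeW => w; case/andP: (AYB w).
by rewrite -!lee_fin !fineK ?fin_num_measure// EA EB.
Qed.

End fine_probability.

(** An event instead of a maximum: the empty block gives the whole space, hence [block_df X u 0 = 1]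
    as [survival] demands, whereas [partial_max X 0] is a dummy. *)
Definition block_event d (T : measurableType d) (R : realType)
    (P : probability T R) (X : nat -> {RV P >-> R}) (a n : nat) (u : R) : set T :=
  [set w | forall j, (a <= j < a + n)%N -> X j w <= u].

Definition block_df d (T : measurableType d) (R : realType)
    (P : probability T R) (X : nat -> {RV P >-> R}) (u : R) (n : nat) : R :=
  fine (P (block_event X 0 n u)).

Section block_df.
Context d (T : measurableType d) (R : realType) (P : probability T R).
Context (X : nat -> {RV P >-> R}).

Lemma measurable_block_event a n u : measurable (block_event X a n u).
Proof.
rewrite (_ : block_event X a n u =
    \bigcap_(j in [set j | (a <= j < a + n)%N]) (X j @^-1` `]-oo, u])).
  apply: bigcap_measurableType => j _.
  by rewrite -[X in measurable X]setTI; exact: measurable_funP.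
apply/seteqP; split=> w hw j hj.
  by rewrite /= in_itv/= hw.
by have := hw j hj; rewrite /= in_itv/=.
Qed.

Lemma block_event0 a u : block_event X a 0 u = setT.
Proof. by apply/seteqP; split=> // w _ j; rewrite addn0; lia. Qed.

Lemma block_event_cat a n m u :
  block_event X a (n + m) u = block_event X a n u `&` block_event X (a + n) m u.
Proof.
apply/seteqP; split=> w.
  by move=> hw; split=> j hj; apply: hw; lia.
move=> [h1 h2] j hj; have [jn|jn] := ltnP j (a + n).
  by apply: h1; lia.
by apply: h2; lia.
Qed.

Lemma block_event_le a n u v : u <= v -> block_event X a n u `<=` block_event X a n v.
Proof. by move=> uv w hw j /hw /le_trans; apply. Qed.

Lemma partial_max_le n u : (0 < n)%N ->
  [set w | partial_max X n w <= u] = block_event X 0 n u.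
Proof.
case: n => // n _; apply/seteqP; split=> w /=.
  by move=> /bigmax_leP[_ h] j /andP[_ jn]; exact: (h (Ordinal jn)).
move=> h; apply/bigmax_leP; split; first exact: h.
by move=> j _; apply: h; rewrite add0n/=.
Qed.

Lemma block_df_survival u : survival (block_df X u).
Proof.
split.
- by rewrite /block_df block_event0 probability_setT.
- by move=> n; have /andP[] := fine_probability_itv P (measurable_block_event 0 n u).
- move=> i j ij; apply: fine_probability_le; try exact: measurable_block_event.
  by move=> w hw k /andP[k0 ki]; apply: hw; lia.
Qed.

Lemma block_df_homo n : {homo (block_df X)^~ n : u v / u <= v}.
Proof.
move=> u v uv; apply: fine_probability_le; try exact: measurable_block_event.
exact: block_event_le.
Qed.

Lemma block_df1 u : block_df X u 1 = marginal_df X u.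
Proof.
rewrite /block_df /marginal_df /cdf /distribution /pushforward; congr (fine (P _)).
apply/seteqP; split=> w /=; rewrite in_itv/=; first by apply.
by move=> h [|j]//.
Qed.

Context (hstat : strictly_stationary X).

Lemma fine_probability_block_event a n u :
  fine (P (block_event X a n u)) = block_df X u n.
Proof.
pose A : set (n.-tuple R) := [set x | forall k, tnth x k <= u].
have mA : measurable A.
  rewrite (_ : A = \bigcap_(k in [set: 'I_n]) ((tnth (T := R))^~ k @^-1` `]-oo, u])).
    apply: fin_bigcap_measurable => // k _.
    by rewrite -[X in measurable X]setTI; exact: measurable_tnth.
  apply/seteqP; split=> x hx k; first by move=> _; rewrite /= in_itv/= hx.
  by have := hx k I; rewrite /= in_itv/=.
rewrite /block_df; congr fine; have := @hstat n a A mA.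
rewrite (_ : [set w | A [tuple X (j + a)%N w | j < n]] =
    block_event X a n u); last first.
  apply/seteqP; split=> w /= h j.
    move=> ajn; have jn : (j - a < n)%N by lia.
    by have := h (Ordinal jn); rewrite tnth_mktuple/= subnK//; case/andP: ajn.
  by rewrite tnth_mktuple; apply: h; rewrite leq_addl/= addnC ltn_add2l.
move=> ->; congr (P _); apply/seteqP; split=> w /= h j.
  by move=> jn; have := h (Ordinal jn); rewrite tnth_mktuple.
by rewrite tnth_mktuple; apply: h => /=.
Qed.

Lemma block_event_enlarge a n u v c : u <= v ->
  marginal_df X v - marginal_df X u <= c ->
  fine (P (block_event X a n v)) - fine (P (block_event X a n u)) <= n%:R * c.
Proof.
move=> uv uvc; rewrite !fine_probability_block_event.
elim: n => [|n ih]; first by rewrite /block_df !block_event0 mul0r subrr.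
rewrite -[n.+1]addn1 natrD mulrDl mul1r /block_df !block_event_cat.
have mE := measurable_block_event.
have := fine_probabilityI_le P (mE 0 n u) (mE (0 + n) 1 u)%N
  (mE 0 n v) (mE (0 + n) 1 v)%N (block_event_le uv) (block_event_le uv).
rewrite ![fine (P (block_event X (0 + n) 1 _))]fine_probability_block_event.
rewrite !block_df1.
by move: ih; rewrite /block_df; lra.
Qed.

End block_df.

(** * Decorrelation through Lipschitz ramps *)

Lemma prod_lipschitz (R : realType) (s : nat) (a b : 'I_s -> R) :
  (forall k, 0 <= a k <= 1) -> (forall k, 0 <= b k <= 1) ->
  `|\prod_(k < s) a k - \prod_(k < s) b k| <= \sum_(k < s) `|a k - b k|.
Proof.
move=> ha hb.
(* The induction must also carry that the partial products stay in [0,1], which keeps the Lipschitz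
   constant equal to 1. *)
suff [] : [/\ `|\prod_(k < s) a k - \prod_(k < s) b k| <= \sum_(k < s) `|a k - b k|,
  0 <= \prod_(k < s) a k <= 1 & 0 <= \prod_(k < s) b k <= 1] by [].
elim/big_rec3: _ => [|k z y x _ [xyz /andP[x0 x1] /andP[y0 y1]]].
  by split; rewrite ?subrr ?normr0 ?lexx ?ler01.
have /andP[a0 a1] := ha k; have /andP[b0 b1] := hb k; split; last 2 first.
- by rewrite mulr_ge0//= mulr_ile1.
- by rewrite mulr_ge0//= mulr_ile1.
have -> : a k * x - b k * y = a k * (x - y) + (a k - b k) * y by ring.
rewrite (le_trans (ler_normD _ _))// addrC lerD//.
  by rewrite normrM (ger0_norm y0) ler_piMr.
by rewrite normrM (ger0_norm a0) (le_trans _ xyz)// ler_piMl.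
Qed.

(** A Lipschitz substitute for the indicator that all coordinates are at most [u], squeezed between
    the indicators at levels [u] and [u + w]. In the l^1 distance used by [Lip] its constant is at
    most 1/w whatever [s] is. *)
Definition ramp (R : realType) (s : nat) (u w : R) (x : s.-tuple R) : R :=
  \prod_(k < s) clamp01 ((u + w - tnth x k) / w).

Section ramp.
Context (R : realType) (s : nat) (u w : R).
Context (w0 : 0 < w).
Implicit Type x : s.-tuple R.

Lemma ramp_itv x : 0 <= ramp u w x <= 1.
Proof.
rewrite /ramp; elim/big_ind: _ => [|a b /andP[? ?] /andP[? ?]|k _].
- by rewrite ler01 lexx.
- by rewrite mulr_ge0//= mulr_ile1.
- exact: clamp01_itv.
Qed.

Lemma ramp1 x : (forall k, tnth x k <= u) -> ramp u w x = 1.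
Proof.
move=> xu; rewrite /ramp big1// => k _.
by rewrite clamp01_ge1// ler_pdivlMr// mul1r; have := xu k; lra.
Qed.

Lemma ramp0 x k : u + w <= tnth x k -> ramp u w x = 0.
Proof.
move=> uk; rewrite /ramp (bigD1 k)//= clamp01_le0 ?mul0r//.
by rewrite pmulr_lle0 ?invr_gt0// subr_le0.
Qed.

Lemma ramp_lipschitz x y :
  `|ramp u w x - ramp u w y| <= w^-1 * \sum_(k < s) `|tnth x k - tnth y k|.
Proof.
apply: (le_trans (prod_lipschitz _ _)) => [k|k|]; try exact: clamp01_itv.
rewrite mulr_sumr; apply: ler_sum => k _.
rewrite (le_trans (clamp01_lipschitz _ _))// -mulrBl normrM mulrC.
rewrite (@gtr0_norm _ w^-1) ?invr_gt0// ler_pM2l ?invr_gt0//.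
by rewrite distrC opprB addrC addrA subrK.
Qed.

Lemma measurable_ramp : measurable_fun [set: s.-tuple R] (@ramp R s u w).
Proof.
apply: measurable_prod => k _.
apply: measurable_minr; first exact: measurable_cst.
apply: measurable_maxr; first exact: measurable_cst.
apply: measurable_funM; last exact: measurable_cst.
apply: measurable_funB; first exact: measurable_cst.
exact: measurable_tnth.
Qed.

Lemma ramp_test_function : (0 < s)%N -> test_function (@ramp R s u w).
Proof.
move=> s0; split; first exact: measurable_ramp; last first.
  by move=> x; have /andP[? ?] := ramp_itv x; rewrite ger0_norm.
exists [tuple u | _ < s], [tuple u + w | _ < s].
rewrite ramp1; last by move=> k; rewrite tnth_mktuple.
rewrite (@ramp0 _ (Ordinal s0)) ?tnth_mktuple//.
by apply/eqP; rewrite oner_eq0.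
Qed.

Lemma Lip_ramp : (Lip (@ramp R s u w) <= (w^-1)%:E)%E.
Proof.
apply: ge_ereal_sup => _ [x [y [yx ->]]]; rewrite lee_fin.
have [->|S0] := eqVneq (\sum_(k < s) `|tnth y k - tnth x k|) 0.
  by rewrite invr0 mulr0 invr_ge0 ltW.
rewrite ler_pdivrMr ?ramp_lipschitz// lt_neqAle eq_sym S0/=.
by apply: sumr_ge0 => k _.
Qed.

End ramp.

Lemma Lip_gt0 (R : realType) (s : nat) (f : s.-tuple R -> R) :
  test_function f -> (0 < Lip f)%E.
Proof.
move=> [_ [x [y fxy]] _]; apply: (@lt_le_trans _ _
  (`|f y - f x| / \sum_(k < s) `|tnth y k - tnth x k|)%:E); last first.
  apply: ereal_sup_ubound; exists x, y; split=> // yx.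
  by apply: fxy; rewrite yx.
rewrite lte_fin divr_gt0//.
  by rewrite normr_gt0 subr_eq0; apply/eqP => e; exact: fxy.
rewrite lt_neqAle sumr_ge0 ?andbT; last by move=> k _.
rewrite eq_sym; apply/negP; rewrite psumr_eq0; last by move=> k _.
move=> /allP h; apply: fxy; congr f; apply: eq_from_tnth => k.
have := h k (mem_index_enum k); rewrite normr_eq0 subr_eq0 => /eqP //.
Qed.

Section kappa_bound.
Context d (T : measurableType d) (R : realType) (P : probability T R).
Context (X : nat -> {RV P >-> R}).

(** The Lipschitz constants are positive by [Lip_gt0] and finite by assumption, so the extended
    ratio in [kappa] is a genuine real quotient and its denominator can be cleared. *)
Lemma covariance_le_kappa (s t : nat) (f : s.-tuple R -> R) (g : t.-tuple R -> R)
    (i : s.-tuple nat) (j : t.-tuple nat) (r : nat) (c k a b : R) :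
  (0 < s)%N -> (0 < t)%N -> test_function f -> test_function g ->
  sorted leq (i ++ j) -> (last 0 i + r <= head 0 j)%N ->
  (Lip f <= a%:E)%E -> (Lip g <= b%:E)%E -> (kappa X r <= k%:E)%E ->
  covariance P (f \o sample X i) (g \o sample X j) = c%:E ->
  `|c| <= s%:R * t%:R * (a * b) * k.
Proof.
move=> s0 t0 tf tg ij gap fa gb kk cE.
have : (`|c%:E| / (s%:R%:E * t%:R%:E * (Lip f * Lip g)) <= k%:E)%E.
  apply: le_trans kk; apply: ereal_sup_ubound.
  by exists s, t, f, g, i, j; rewrite cE; split.
have f0 := Lip_gt0 tf; have g0 := Lip_gt0 tg.
move: (Lip f) (Lip g) f0 g0 fa gb => [l| |] [m| |]//.
rewrite !lte_fin !lee_fin => l0 m0 la mb.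
have s0R : 0 < s%:R :> R by rewrite ltr0n.
have t0R : 0 < t%:R :> R by rewrite ltr0n.
have D0 : 0 < s%:R * t%:R * (l * m) by rewrite !mulr_gt0.
rewrite -!EFinM inver gt_eqF// -EFinM lee_fin ler_pdivrMr// => ck.
have k0 : 0 <= k by rewrite -(pmulr_lge0 _ D0) (le_trans _ ck).
rewrite (le_trans ck)// mulrC ler_wpM2r// ler_wpM2l ?mulr_ge0//.
by apply: ler_pM => //; exact: ltW.
Qed.

End kappa_bound.

(** Intended reading: [x], [x'] are the probabilities of the first block event at levels [u] and
    [u + dl], and [y] is the mean of its ramp; [v], [z], [v'] play the same roles for the second
    block, and [m], [w], [m'] for the two jointly. *)
Lemma covariance_sandwich (R : realFieldType)
    (x y x' v z v' m w m' K a b : R) :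
  x <= y <= x' -> v <= z <= v' -> m <= w <= m' -> `|w - y * z| <= K ->
  0 <= v -> v' <= 1 -> 0 <= x -> x <= 1 ->
  x' - x <= a -> v' - v <= b -> m' <= m + (x' - x) + (v' - v) ->
  `|m - x * v| <= a + b + K.
Proof.
move=> /andP[xy yx'] /andP[vz zv'] /andP[mw wm'] /ler_normlP[k1 k2].
move=> v0 v1 x0 x1 xa vb mm.
have E : y * z - x * v = (y - x) * z + x * (z - v) by ring.
have h1 : 0 <= (y - x) * z by rewrite mulr_ge0 ?subr_ge0// (le_trans v0).
have h2 : 0 <= x * (z - v) by rewrite mulr_ge0 ?subr_ge0.
have h3 : (y - x) * z <= y - x by rewrite ler_piMr ?subr_ge0// (le_trans zv').
have h4 : x * (z - v) <= z - v by rewrite ler_piMl ?subr_ge0.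
by rewrite ler_norml; apply/andP; split; lra.
Qed.

Lemma sorted_iota_cat p r q : sorted leq (iota 0 p ++ iota (p + r) q).
Proof.
apply: (subseq_sorted leq_trans _ (iota_sorted 0 (p + r + q))).
by rewrite !iotaD/= -catA cat_subseq// suffix_subseq.
Qed.

Lemma iota_gap p r q : (0 < p)%N -> (0 < q)%N ->
  (last 0 (iota 0 p) + r <= head 0 (iota (p + r) q))%N.
Proof.
move=> p0 q0; rewrite -nth_last -nth0 size_iota !nth_iota ?prednK//.
by rewrite addn0 add0n leq_add2r leq_pred.
Qed.

Section block_mixing_bound.
Context d (T : measurableType d) (R : realType) (P : probability T R).
Context (X : nat -> {RV P >-> R}).
Context (hstat : strictly_stationary X).

Lemma measurable_sample s (i : s.-tuple nat) :
  measurable_fun [set: T] (sample X i).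
Proof.
apply/measurable_fun_tnthP => k.
rewrite (_ : _ \o _ = X (tnth i k)); first exact: measurable_funP.
by apply/funext => w; rewrite /= tnth_mktuple.
Qed.

Lemma tnth_sample_iota a n (k : 'I_n) w :
  tnth (sample X [tuple of iota a n] w) k = X (a + k)%N w.
Proof. by rewrite tnth_mktuple (tnth_nth 0%N) nth_iota. Qed.

Lemma ramp_sample_between a n u (dl : R) w : 0 < dl ->
  \1_(block_event X a n u) w <= ramp u dl (sample X [tuple of iota a n] w)
    <= \1_(block_event X a n (u + dl)) w.
Proof.
move=> dl0; have /andP[r0 r1] := ramp_itv u dl (sample X [tuple of iota a n] w).
apply/andP; split; rewrite indicE.
  case: (asboolP (block_event X a n u w)) => [h|h].
    rewrite ramp1 ?lern1 ?leq_b1// => k; rewrite tnth_sample_iota.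
    by apply: h; rewrite leq_addr ltn_add2l/=.
  by rewrite memNset.
have [h|/existsNP[j /not_implyP[/andP[aj jn] /negP]]] :=
  pselect (block_event X a n (u + dl) w).
  by rewrite mem_set.
rewrite -ltNge => Xj; have jan : (j - a < n)%N by rewrite ltn_subLR.
rewrite (@ramp0 _ _ _ _ dl0 _ (Ordinal jan)) ?ler0n//.
by rewrite tnth_sample_iota/= subnKC// ltW.
Qed.

(** The first error is the cost of raising the level from [u] to [u + dl] at all [p + q] positions.
    The second is the [kappa] bound for two ramps of Lipschitz constant at most [dl^-1]. *)
Lemma block_covariance p r q u (dl c k : R) : 0 < dl -> 0 <= c -> 0 <= k ->
  marginal_df X (u + dl) - marginal_df X u <= c -> (kappa X r <= k%:E)%E ->
  `|fine (P (block_event X 0 p u `&` block_event X (p + r) q u)) -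
    block_df X u p * block_df X u q| <=
  (p + q)%:R * c + p%:R * q%:R * (dl^-1 * dl^-1) * k.
Proof.
move=> dl0 c0 k0 Fc kk.
have B0 : 0 <= (p + q)%:R * c + p%:R * q%:R * (dl^-1 * dl^-1) * k.
  by rewrite addr_ge0 ?mulr_ge0// invr_ge0 ltW.
(* [kappa] ranges over nonempty tuples only; with an empty block the left side is exactly 0. *)
have [p0|p0] := posnP p.
  rewrite p0 add0n block_event0 setTI fine_probability_block_event//.
  by rewrite /block_df block_event0 probability_setT mul1r subrr normr0 -p0.
have [q0|q0] := posnP q.
  rewrite q0 block_event0 setIT /block_df block_event0 probability_setT mulr1.
  by rewrite subrr normr0 -q0.
have mE := measurable_block_event X.
have udl : u <= u + dl by rewrite lerDl ltW.
pose Y := ramp u dl \o sample X [tuple of iota 0 p].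
pose Z := ramp u dl \o sample X [tuple of iota (p + r) q].
have mY : measurable_fun [set: T] Y.
  by apply: measurableT_comp; [exact: measurable_ramp|exact: measurable_sample].
have mZ : measurable_fun [set: T] Z.
  by apply: measurableT_comp; [exact: measurable_ramp|exact: measurable_sample].
have [LY Yb] := expectation_between_indic P (mE 0%N p u) (mE 0%N p (u + dl)) mY
  (fun w => ramp_sample_between 0 p u w dl0).
have [LZ Zb] := expectation_between_indic P (mE (p + r)%N q u)
  (mE (p + r)%N q (u + dl)) mZ (fun w => ramp_sample_between (p + r) q u w dl0).
have [LW Wb] : (Y * Z)%R \in Lfun P 1 /\
    fine (P (block_event X 0 p u `&` block_event X (p + r) q u))
    <= fine 'E_P[Y * Z] <=
    fine (P (block_event X 0 p (u + dl) `&` block_event X (p + r) q (u + dl))).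
  apply: expectation_between_indic; try exact: measurableI.
    exact: measurable_funM.
  move=> w; rewrite !indicI.
  have /andP[y1 y2] := ramp_sample_between 0 p u w dl0.
  have /andP[z1 z2] := ramp_sample_between (p + r) q u w dl0.
  have /andP[Y0 _] := ramp_itv u dl (sample X [tuple of iota 0 p] w).
  have /andP[Z0 _] := ramp_itv u dl (sample X [tuple of iota (p + r) q] w).
  by apply/andP; split; apply: ler_pM => //; rewrite indicE.
have enlarge a n : fine (P (block_event X a n (u + dl))) -
    fine (P (block_event X a n u)) <= n%:R * c by exact: block_event_enlarge.
have := fine_probabilityI_le P (mE 0%N p u) (mE (p + r)%N q u)
  (mE 0%N p (u + dl)) (mE (p + r)%N q (u + dl))
  (block_event_le udl) (block_event_le udl).
have /andP[v0 _] := fine_probability_itv P (mE (p + r)%N q u).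
have /andP[_ v1] := fine_probability_itv P (mE (p + r)%N q (u + dl)).
have /andP[x0 x1] := fine_probability_itv P (mE 0%N p u).
have := enlarge (p + r)%N q; have := enlarge 0%N p.
rewrite -[block_df X u q](fine_probability_block_event hstat (p + r)).
rewrite [block_df X u p]/block_df.
have covE : covariance P Y Z =
    (fine 'E_P[Y * Z] - fine 'E_P[Y] * fine 'E_P[Z])%:E.
  by rewrite covarianceE// EFinB EFinM !fineK ?expectation_fin_num.
have := @covariance_le_kappa _ _ _ _ X p q _ _ _ _ r _ k dl^-1 dl^-1
  p0 q0 (ramp_test_function u dl0 p0) (ramp_test_function u dl0 q0) _ _
  (Lip_ramp p u dl0) (Lip_ramp q u dl0) kk covE.
move=> /(_ (sorted_iota_cat p r q) (iota_gap r p0 q0)) cov xle vle mle.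
rewrite natrD mulrDl.
exact: (covariance_sandwich Yb Zb Wb cov v0 v1 x0 x1 xle vle mle).
Qed.

End block_mixing_bound.

Lemma powRN_small (R : realType) (a e : R) : 0 < a -> 0 < e ->
  exists N, forall n, (N <= n)%N -> n%:R `^ (- a) <= e.
Proof.
move=> a0 e0; exists (Num.truncn (e^-1 `^ a^-1)).+1 => n Nn.
have : e^-1 `^ a^-1 <= n%:R.
  by rewrite ltW// (lt_le_trans (truncnS_gt _))// ler_nat.
move=> /(ge0_ler_powR (ltW a0)); rewrite !nnegrE powR_ge0 ler0n => /(_ isT isT).
rewrite -powRrM mulVf ?gt_eqF// powRr1 ?invr_ge0 ?(ltW e0)// => en.
rewrite powRN -[leRHS]invrK lef_pV2 ?posrE ?invr_gt0//.
by rewrite (lt_le_trans _ en)// invr_gt0.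
Qed.

Section main_estimates.
Context d (T : measurableType d) (R : realType) (P : probability T R).
Context (X : nat -> {RV P >-> R}).
Context (hstat : strictly_stationary X).

Lemma block_gap p r q u :
  let D := fine (P (block_event X 0 p u `&` block_event X (p + r) q u)) in
  block_df X u (p + r + q)%N <= D <=
    block_df X u (p + r + q)%N + (1 - block_df X u r).
Proof.
have mE := measurable_block_event X.
have mD : measurable (block_event X 0 p u `&` block_event X (p + r) q u).
  exact: measurableI.
have mC : measurable (~` block_event X p r u) by exact: measurableC.
apply/andP; split.
  apply: fine_probability_le => // w; rewrite !block_event_cat.
  by rewrite !add0n => -[[? ?] ?]; split.
have -> : 1 - block_df X u r = fine (P (~` block_event X p r u)).
  rewrite -(fine_probability_block_event hstat p) -setTD fine_probabilityD//.
  by rewrite probability_setT.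
apply: le_trans (fine_probabilityU _ _ _) => //.
apply: fine_probability_le => //; first exact: measurableU.
move=> w [w1 w2]; rewrite !block_event_cat !add0n.
by have [?|?] := pselect (block_event X p r u w); [left; split|right].
Qed.

Lemma block_df_lipschitz u v n :
  `|block_df X u n - block_df X v n| <= n%:R * `|marginal_df X u - marginal_df X v|.
Proof.
wlog uv : u v / u <= v => [hw|].
  by case: (leP u v) => [/hw//|/ltW /hw]; rewrite distrC (distrC (marginal_df X v)).
rewrite distrC ger0_norm ?subr_ge0 ?block_df_homo//.
by apply: block_event_enlarge => //; rewrite distrC ler_norm.
Qed.

Lemma block_df_ge u n : 1 - n%:R * (1 - marginal_df X u) <= block_df X u n.
Proof.
elim: n => [|n ih].
  by rewrite mul0r subr0 /block_df block_event0 probability_setT.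
have mE := measurable_block_event X.
have := fine_probabilityI_le P (mE 0%N n u) (mE (0 + n)%N 1%N u)
  (@measurableT _ T) (@measurableT _ T) (@subsetT _ _) (@subsetT _ _).
rewrite setIT -block_event_cat addn1.
rewrite [fine (P (block_event X _ 1 u))]fine_probability_block_event// block_df1.
rewrite probability_setT -/(block_df X u n) -/(block_df X u n.+1) /= -natr1.
by move: ih; lra.
Qed.

(** For p + q = O(r) and [dl] = r^(-a), the smoothing error is of order r * dl^b = r^(1-ab) and the
    covariance error of order r^2 * dl^(-2) * r^(-beta) = r^(2+2a-beta). With a = 1/b + 1/2 these
    are r^(-b/2) and r^(-eta), where [eta] = beta - 3 - 2/b > 0. *)
Lemma block_df_mixing (b B beta : R) : 0 < b -> 0 < B ->
  (forall x t : R, 0 < t -> marginal_df X (x + t) - marginal_df X x <= B * t `^ b) ->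
  3 + 2 / b < beta -> kappa_rate X beta -> block_mixing (block_df X).
Proof.
move=> b0 B0 hF hbeta [C [N0 _ hC]] c e e0.
pose K : R := Num.max 0 C.
have K0 : 0 <= K by rewrite le_max lexx.
pose eta := beta - (3 + 2 / b); have eta0 : 0 < eta by rewrite subr_gt0.
pose a : R := b^-1 + 2^-1.
(* [c.+1] and [K + 1] replace [c] and [K], which may be 0, as divisors. *)
have cB0 : 0 < e / 2 / (c.+1%:R * B) by rewrite !divr_gt0// mulr_gt0.
have cK0 : 0 < e / 2 / (c.+1%:R ^+ 2 * (K + 1)).
  by rewrite !divr_gt0// mulr_gt0 ?exprn_gt0// ltr_pwDr.
have [N1 hN1] := @powRN_small R (b / 2) _ ltac:(by rewrite divr_gt0) cB0.
have [N2 hN2] := @powRN_small R eta _ eta0 cK0.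
exists (maxn N0 (maxn N1 N2)).+1 => r Nr u p q pqr.
move: (ltnW Nr) (leq_ltn_trans (leq0n _) Nr) => + r0.
rewrite !geq_max => /and3P[rN0 rN1 rN2].
have rp : 0 < r%:R :> R by rewrite ltr0n.
have rn : r%:R != 0 :> R by rewrite gt_eqF.
have rD x y : r%:R `^ (x + y) = r%:R `^ x * r%:R `^ y :> R.
  by rewrite powRD// rn implybT.
pose dl : R := r%:R `^ (- a); have dl0 : 0 < dl by exact: powR_gt0.
have kr : (kappa X r <= (K * r%:R `^ (- beta))%:E)%E.
  apply: (le_trans (hC r rN0)); rewrite lee_fin ler_wpM2r ?powR_ge0//.
  by rewrite le_max lexx orbT.
have := @block_covariance _ _ _ _ X hstat p r q u dl (B * dl `^ b)
  (K * r%:R `^ (- beta)) dl0.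
rewrite !mulr_ge0 ?powR_ge0 ?(ltW B0)// => /(_ isT isT (hF u dl dl0) kr).
have pq : (p + q)%:R <= c%:R * r%:R :> R by rewrite -natrM ler_nat.
have pq2 : p%:R * q%:R <= c%:R ^+ 2 * r%:R ^+ 2 :> R.
  rewrite -exprMn expr2 ler_pM// (le_trans _ pq)// ler_nat ?leq_addr ?leq_addl//.
have t1 : (p + q)%:R * (B * dl `^ b) <= e / 2.
  apply: (@le_trans _ _ (c%:R * B * r%:R `^ (- (b / 2)))).
    have -> : c%:R * B * r%:R `^ (- (b / 2)) = c%:R * r%:R * (B * dl `^ b).
      rewrite /dl -powRrM (_ : - (b / 2) = 1 + - a * b).
        rewrite rD powRr1 ?ler0n//; ring.
      by rewrite /a; field; rewrite gt_eqF.
    by rewrite ler_wpM2r// mulr_ge0 ?powR_ge0 ?ltW.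
  apply: (@le_trans _ _ (c.+1%:R * B * (e / 2 / (c.+1%:R * B)))).
    apply: ler_pM; rewrite ?powR_ge0 ?hN1// ?mulr_ge0 ?(ltW B0)//.
    by rewrite ler_wpM2r ?(ltW B0)// ler_nat.
  by rewrite mulrC divfK// mulf_neq0 ?gt_eqF.
have t2 : p%:R * q%:R * (dl^-1 * dl^-1) * (K * r%:R `^ (- beta)) <= e / 2.
  apply: (@le_trans _ _ (c%:R ^+ 2 * K * r%:R `^ (- eta))).
    have -> : c%:R ^+ 2 * K * r%:R `^ (- eta) =
        c%:R ^+ 2 * r%:R ^+ 2 * (dl^-1 * dl^-1) * (K * r%:R `^ (- beta)).
      rewrite /dl -powRN opprK -[r%:R ^+ 2]powR_mulrn ?ler0n//.
      have -> : - eta = 2%:R + (a + (a + - beta)).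
        by rewrite /a /eta; field; rewrite gt_eqF.
      by rewrite (rD 2%:R) (rD a (a + - beta)) (rD a (- beta)); ring.
    rewrite ler_wpM2r ?mulr_ge0 ?powR_ge0// ler_wpM2r// mulr_ge0// invr_ge0 ltW//.
  apply: (@le_trans _ _
    (c.+1%:R ^+ 2 * (K + 1) * (e / 2 / (c.+1%:R ^+ 2 * (K + 1))))).
    apply: ler_pM; rewrite ?powR_ge0 ?hN2// ?mulr_ge0 ?exprn_ge0//.
    apply: ler_pM; rewrite ?exprn_ge0// ?lerDl//.
    by rewrite lerXn2r ?nnegrE ?ler0n// ler_nat.
  rewrite mulrC divfK// mulf_neq0// ?expf_neq0 ?pnatr_eq0// gt_eqF//.
  by rewrite ltr_pwDr.
have /andP[d1 d2] := block_gap p r q u.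
by move=> /ler_normlP[n1 n2]; split; lra.
Qed.

End main_estimates.

(** * Conclusion *)

(** One term suffices: a fixed large [n] brings the exponential close to 1, and for large [u] the
    clamp of that term is saturated. *)
Lemma phantom_cvgy (R : realType) (h : R -> nat -> R) :
  (forall n, h^~ n @ +oo --> (1 : R)) -> phantom h @ +oo --> (1 : R).
Proof.
move=> h1; apply/cvgrPdist_le => /= e e0.
have [M hM] := expRNV_near1 e0.
pose n := maxn M 3.
have q0 : 0 < 1 / 4 :> R by rewrite divr_gt0.
have := h1 n.+1 => /cvgrPdist_le /(_ _ q0); apply: filterS => u /= hu.
have /andP[_ G1] := phantom_itv h u.
have n4 : 4 <= n.+1%:R :> R by rewrite ler_nat ltnS leq_maxr.
have := hM n.+1 (leqW (leq_maxl _ _)).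
have : expR (- n.+1%:R^-1) <= phantom h u.
  apply: le_trans (phantom_term_le h n u); apply: expR_le_phantom_term.
  have := expRN1_lt_half R; move: hu => /ler_normlP[_ hu]; nra.
by move=> ? ?; rewrite ger0_norm ?subr_ge0//; lra.
Qed.

(** Once [h u 1] is at most 1/e, monotonicity in the length kills every term, so the limit is
    attained exactly. *)
Lemma phantom_cvgNy (R : realType) (h : R -> nat -> R) :
  (forall u, survival (h u)) -> h^~ 1%N @ -oo --> (0 : R) ->
  phantom h @ -oo --> (0 : R).
Proof.
move=> sh h0; apply/cvgrPdist_le => /= e e0.
have := h0 => /cvgrPdist_le /(_ _ (expR_gt0 (-1))); apply: filterS => u /= hu.
suff -> : phantom h u = 0 by rewrite subrr normr0 ltW.
have [_ _ hd] := sh u; have /andP[G0 _] := phantom_itv h u.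
apply/eqP; rewrite eq_le G0 andbT; apply: phantom_ub => n.
rewrite phantom_term0// (le_trans (hd 1%N _ _))//.
by move: hu => /ler_normlP[+ _]; rewrite opprB subr0.
Qed.

Lemma continuous_cumulative (R : realType) (G : R -> R) :
  {homo G : x y / x <= y} -> continuous G ->
  G @ -oo --> (0 : R) -> G @ +oo --> (1 : R) ->
  exists H : cumulativeBounded (0 : R) (1 : R), (H : R -> R) = G.
Proof.
move=> Gh Gc G0 G1.
have Gr : right_continuous G by move=> x; exact: cvg_at_right_filter (Gc x).
pose m1 := isCumulative.Build R _ R G Gh Gr.
pose C : cumulative R R := HB.pack G m1.
pose m2 := isCumulativeBounded.Build R 0 1 C G0 G1.
by exists (HB.pack_for (cumulativeBounded (0 : R) (1 : R)) G m1 m2).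
Qed.

Lemma cvg_ereal_sup_dist (R : realType) (I : Type) (i0 : I) (f : nat -> I -> R) :
  (forall e, 0 < e -> exists N, forall n, (N <= n)%N -> forall i, `|f n i| <= e) ->
  (fun n => ereal_sup (range (fun i => `|(f n i)%:E|%E))) @ \oo --> 0%E.
Proof.
move=> hf; have lb n : (0 <= ereal_sup (range (fun i => `|(f n i)%:E|)))%E.
  apply: (@le_trans _ _ `|(f n i0)%:E|%E); first by rewrite abse_ge0.
  by apply: ereal_sup_ubound; exists i0.
have ub (e : R) n : (forall i, `|f n i| <= e) ->
    (ereal_sup (range (fun i => `|(f n i)%:E|)) <= e%:E)%E.
  by move=> h; apply: ge_ereal_sup => _ [i _ <-]; rewrite lee_fin.
apply/fine_cvgP; split.
  have [N hN] := hf 1 ltr01; exists N => // n /= Nn.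
  by rewrite ge0_fin_numE ?lb// (le_lt_trans (ub _ _ (hN n Nn)))// ltry.
apply/cvgrPdist_le => /= e e0; have [N hN] := hf e e0; exists N => // n /= Nn.
rewrite sub0r normrN ger0_norm ?fine_ge0 ?lb// -lee_fin fineK.
  exact: ub (hN n Nn).
by rewrite ge0_fin_numE ?lb// (le_lt_trans (ub _ _ (hN n Nn)))// ltry.
Qed.

Unset Implicit Arguments.
Set Strict Implicit.
Set Printing Implicit Defensive.

Theorem theorem4p9 (d : measure_display) (T : measurableType d) (R : realType)
    (P : probability T R) (X : nat -> {RV P >-> R}) (b B : R)
    (hstat : strictly_stationary X)
    (hcont : continuous (marginal_df X : R -> R))
    (hb : 0 < b) (hB : 0 < B)
    (hF : forall x u : R, 0 < u ->
       marginal_df X (x + u) - marginal_df X x <= B * u `^ b)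
    (hkappa : kappa_weakly_dependent X)
    (hrate : exists beta : R,
       (1 + Num.sqrt 5) * (1 + 2 / b) < beta /\ kappa_rate X beta) :
  exists G : cumulativeBounded (0 : R) (1 : R),
    continuous (G : R -> R) /\ phantom_df X G.
Proof.
have [beta [hbeta hC]] := hrate.
have s5 : 2 <= Num.sqrt 5 :> R.
  by rewrite -[leLHS](ger0_norm (ler0n R 2)) -sqrtr_sqr ler_sqrt; lra.
have b2 : 0 < 2 / b by rewrite divr_gt0.
(* As 1 + sqrt 5 >= 3, the assumed threshold is at least 3 + 6/b. *)
have hbeta3 : 3 + 2 / b < beta.
  by apply: le_lt_trans hbeta; move: (2 / b) b2 => x x0; nra.
have hmix := block_df_mixing hstat hb hB hF hbeta3 hC.
have hsurv := block_df_survival X.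
pose h := block_df X.
have hlip := block_df_lipschitz hstat.
have hc n : continuous (h ^~ n).
  move=> u; apply/cvgrPdist_le => /= e e0.
  have := hcont u => /cvgrPdist_le /(_ (e / n.+1%:R)).
  move=> /(_ ltac:(by rewrite divr_gt0)); apply: filterS => v /=.
  rewrite ler_pdivlMr// mulrC; apply: le_trans; apply: (le_trans (hlip u v n)).
  by rewrite ler_wpM2r// ler_nat.
have F0 : marginal_df X @ -oo --> (0 : R) by exact/fine_cvg/cvg_cdfNy0.
have F1 : marginal_df X @ +oo --> (1 : R) by exact/fine_cvg/cvg_cdfy1.
have h0 : h^~ 1%N @ -oo --> (0 : R).
  by rewrite (_ : h^~ 1%N = marginal_df X)//; apply/funext => u; exact: block_df1.
have h1 n : h^~ n @ +oo --> (1 : R).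
  apply/cvgrPdist_le => /= e e0.
  have := F1 => /cvgrPdist_le /(_ (e / n.+1%:R)).
  move=> /(_ ltac:(by rewrite divr_gt0)); apply: filterS => u /=.
  rewrite ler_pdivlMr// => /(le_trans _) Fe.
  rewrite ger0_norm ?subr_ge0 ?survival_le1//.
  have hge := block_df_ge hstat u n.
  apply: (@le_trans _ _ (n%:R * (1 - marginal_df X u))).
    by rewrite -/h in hge *; lra.
  apply: Fe; rewrite mulrC (le_trans (ler_norm _))// normrM (ger0_norm (ler0n _ _)).
  by rewrite ler_wpM2l// ler_nat.
have Gh : {homo phantom h : u v / u <= v}.
  by move=> u v uv; apply: phantom_homo => n; exact: block_df_homo.
have [G GE] := continuous_cumulative Gh (phantom_continuous hsurv hmix hc)
  (phantom_cvgNy hsurv h0) (phantom_cvgy h1).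
exists G; split; first by rewrite GE; exact: phantom_continuous.
have := @cvg_ereal_sup_dist R R 0 (fun n u => h u n - phantom h u ^+ n)
  (fun e e0 => phantom_approx hsurv hmix e0).
(* Starting at 1 avoids the dummy value of [partial_max] at 0; for positive [n] the two suprema
   coincide. *)
apply: cvg_trans; apply: near_eq_cvg; exists 1%N => // n /= n0.
congr ereal_sup; apply: eq_imagel => u _.
have -> : P [set w | partial_max X n w <= u] = (h u n)%:E.
  rewrite partial_max_le// /h /block_df fineK// fin_num_measure//.
  exact: measurable_block_event.
by rewrite GE.
Qed.
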